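(* Let $C$ be the algebra of infinite complex matrices $(a_{i,j})_{i,j\in\mathbb{N}}$ such that the set $\{a_{i,j}: i,j\in\mathbb{N}\}$ is finite and the number of nonzero entries in each row and each column is bounded (i.e. there is a bound, depending on the matrix, valid for all rows and all columns). Let $D$ be the algebra of infinite complex matrices $(a_{i,j})_{i,j\in\mathbb{N}}$ such that the number of nonzero entries in each row and each column is finite. Then the cyclic cohomology groups of $C$ and of $D$ vanish, i.e. $H^n_\lambda(C)=0$ and $H^n_\lambda(D)=0$ for all $n\ge 0$.
   Context: The algebras $C$ and $D$ are unital $\mathbb{C}$-algebras under the usual matrix addition, scalar multiplication and matrix multiplication. Cyclic cohomology is taken in the purely algebraic sense of Connes. For a unital $\mathbb{C}$-algebra $A$ and $n\ge 0$, let $C^n_\lambda(A)$ be the space of $(n+1)$-linear functionals $\varphi:A^{n+1}\to\mathbb{C}$ (no continuity required) satisfying $\varphi(a_1,\dots,a_n,a_0)=(-1)^n\varphi(a_0,a_1,\dots,a_n)$ for all $a_0,\dots,a_n\in A$. The Hochschild coboundary $b:C^n_\lambda(A)\to C^{n+1}_\lambda(A)$ is $$(b\varphi)(a_0,\dots,a_{n+1})=\sum_{j=0}^{n}(-1)^j\varphi(a_0,\dots,a_ja_{j+1},\dots,a_{n+1})+(-1)^{n+1}\varphi(a_{n+1}a_0,a_1,\dots,a_n).$$ Then $b^2=0$, and $H^n_\lambda(A)$ denotes the $n$-th cohomology group of the complex $(C^\bullet_\lambda(A),b)$, $n\ge0$. *)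

(* Defs.v *)
From HB Require Import structures.
From mathcomp Require Import all_boot all_order all_algebra zify.
From mathcomp Require Import boolp classical_sets functions cardinality fsbigop.
From mathcomp Require Import finmap reals complex.

Set Implicit Arguments.
Unset Strict Implicit.
Unset Printing Implicit Defensive.

Import GRing.Theory.

Local Open Scope classical_set_scope.
Local Open Scope card_scope.
Local Open Scope ring_scope.

Section InfiniteMatrices.
Variable K : fieldType.
(* [K^o] is [K] as a vector space over itself, which makes scaling of matrices
   entrywise. *)
Implicit Types a b c : nat -> nat -> K^o.

Definition row_column_finite a : Prop :=
  forall i, finite_set [set j | a i j != 0] /\ finite_set [set j | a j i != 0].

Definition row_column_bounded a : Prop :=
  exists N : nat, forall i,
    [set j | a i j != 0] #<= `I_N /\ [set j | a j i != 0] #<= `I_N.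

Definition finitely_many_entries a : Prop :=
  finite_set [set a ij.1 ij.2 | ij in [set: nat * nat]].

(* The sum ranges over the finitely many [k] with a nonzero summand. *)
Definition infmx_mul a b : nat -> nat -> K^o :=
  fun i j => \sum_(k \in [set: nat]) a i k * b k j.

Definition infmx_one : nat -> nat -> K^o := fun i j => (i == j)%:R.

(* The algebra structures on [rcf_matrix] and [fbb_matrix] below rest on the
   following closure properties. *)
Lemma fsum_seq (f : nat -> K) (s : seq nat) : uniq s ->
  (forall k, f k != 0 -> k \in s) ->
  \sum_(k \in [set: nat]) f k = \sum_(k <- s) f k.
Proof.
move=> us fs; rewrite [RHS]fsbig_seq//.
rewrite -(@fsbig_widen _ _ _ _ [set` s] [set: nat])// => k [_ /= ks].
by apply/eqP; apply: contra_notT ks => /fs.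
Qed.

Lemma finite_setPs (A : set nat) :
  finite_set A <-> exists2 s : seq nat, uniq s & forall x, A x -> x \in s.
Proof.
split=> [/finite_seqP[s ->]|[s us sA]].
  by exists (undup s); rewrite ?undup_uniq// => x; rewrite mem_undup.
by apply: (@sub_finite_set _ _ [set` s]) => //; apply: finite_seq.
Qed.

Lemma card_leIPs (A : set nat) N : A #<= `I_N <->
  exists2 s : seq nat, uniq s /\ (size s <= N)%N & forall x, A x -> x \in s.
Proof.
split=> [AN|[s [us sN] sA]].
  have fA : finite_set A by apply/finite_set_leP; exists N.
  exists (finmap.enum_fset (fset_set A)); last first.
    move=> x Ax; have : x \in fset_set A; last by [].
    by rewrite in_fset_set//; apply: mem_set.
  by split; [exact: finmap.fset_uniq | exact: geq_card_fset_set].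
apply: (@card_le_trans _ _ _ [set` [fset x in s]%fset]).
  by apply: subset_card_le => x /sA xs /=; rewrite in_fset.
apply: (@card_le_trans _ _ _ `I_(size s)); last by rewrite card_le_II.
have : [set` [fset x in s]%fset] #= `I_(size s).
  by apply/card_eq_fsetP; rewrite card_fseq undup_id.
by rewrite card_eq_le => /andP[].
Qed.

Lemma infmx_mul_row a b s i j : uniq s -> (forall k, a i k != 0 -> k \in s) ->
  infmx_mul a b i j = \sum_(k <- s) a i k * b k j.
Proof.
move=> us sa; apply: fsum_seq => // k abk; apply: sa.
by apply: contraNneq abk => ->; rewrite mul0r.
Qed.

Lemma infmx_mul_col a b s i j : uniq s -> (forall k, b k j != 0 -> k \in s) ->
  infmx_mul a b i j = \sum_(k <- s) a i k * b k j.
Proof.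
move=> us sb; apply: fsum_seq => // k abk; apply: sb.
by apply: contraNneq abk => ->; rewrite mulr0.
Qed.

Lemma row_support a (ha : row_column_finite a) i :
  exists2 s : seq nat, uniq s & forall x, a i x != 0 -> x \in s.
Proof. by have /finite_setPs := (ha i).1. Qed.

Lemma col_support a (ha : row_column_finite a) j :
  exists2 s : seq nat, uniq s & forall x, a x j != 0 -> x \in s.
Proof. by have /finite_setPs := (ha j).2. Qed.

Lemma infmx_mulA a b c : row_column_finite a -> row_column_finite c ->
  infmx_mul a (infmx_mul b c) = infmx_mul (infmx_mul a b) c.
Proof.
move=> ha hc; apply/funext => i; apply/funext => j.
have [s us sa] := row_support ha i; have [t ut tc] := col_support hc j.
rewrite (infmx_mul_row _ _ us sa) (infmx_mul_col _ _ ut tc).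
under eq_bigr => k _ do rewrite (infmx_mul_col _ _ ut tc) big_distrr/=.
under [RHS]eq_bigr => k _ do rewrite (infmx_mul_row _ _ us sa) big_distrl/=.
rewrite exchange_big/=; apply: eq_bigr => l _; apply: eq_bigr => k _.
by rewrite mulrA.
Qed.

Lemma infmx_oneP i (s := [:: i]) : uniq s /\
  ((forall k, infmx_one i k != 0 -> k \in s) /\
  (forall k, infmx_one k i != 0 -> k \in s)).
Proof.
split=> //; split=> k; rewrite /infmx_one inE 1?[i == k]eq_sym;
  by case: (k == i); rewrite // eqxx.
Qed.

Lemma infmx_mul1l a : infmx_mul infmx_one a = a.
Proof.
apply/funext => i; apply/funext => j; have [us [s1 _]] := infmx_oneP i.
by rewrite (infmx_mul_row _ _ us s1) big_seq1 /infmx_one eqxx mul1r.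
Qed.

Lemma infmx_mul1r a : infmx_mul a infmx_one = a.
Proof.
apply/funext => i; apply/funext => j; have [us [_ s1]] := infmx_oneP j.
by rewrite (infmx_mul_col _ _ us s1) big_seq1 /infmx_one eqxx mulr1.
Qed.

Lemma infmx_mulDl a b c : row_column_finite c ->
  infmx_mul (a + b) c = infmx_mul a c + infmx_mul b c.
Proof.
move=> hc; apply/funext => i; apply/funext => j.
have [s us sc] := col_support hc j.
rewrite -[RHS]/(infmx_mul a c i j + infmx_mul b c i j).
rewrite !(infmx_mul_col _ _ us sc) -big_split/=.
by apply: eq_bigr => k _; rewrite -mulrDl.
Qed.

Lemma infmx_mulDr a b c : row_column_finite a ->
  infmx_mul a (b + c) = infmx_mul a b + infmx_mul a c.
Proof.
move=> ha; apply/funext => i; apply/funext => j.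
have [s us sa] := row_support ha i.
rewrite -[RHS]/(infmx_mul a b i j + infmx_mul a c i j).
rewrite !(infmx_mul_row _ _ us sa) -big_split/=.
by apply: eq_bigr => k _; rewrite -mulrDr.
Qed.

Lemma infmx_mulZl k a b : row_column_finite b ->
  infmx_mul (k *: a) b = k *: infmx_mul a b.
Proof.
move=> hb; apply/funext => i; apply/funext => j.
have [s us sb] := col_support hb j.
rewrite -[RHS]/(k * infmx_mul a b i j).
rewrite !(infmx_mul_col _ _ us sb) big_distrr/=.
by apply: eq_bigr => l _; rewrite mulrA.
Qed.

Lemma infmx_mulZr k a b : row_column_finite a ->
  infmx_mul a (k *: b) = k *: infmx_mul a b.
Proof.
move=> ha; apply/funext => i; apply/funext => j.
have [s us sa] := row_support ha i.
rewrite -[RHS]/(k * infmx_mul a b i j).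
rewrite !(infmx_mul_row _ _ us sa) big_distrr/=.
by apply: eq_bigr => l _; rewrite mulrCA.
Qed.

Lemma infmx_mul_neq0 a b i j :
  infmx_mul a b i j != 0 -> exists k, a i k != 0 /\ b k j != 0.
Proof.
move=> h; apply: contrapT => /forallNP nh; move/eqP: h; apply.
rewrite /infmx_mul; apply: fsbig1 => k _; have {}nh := nh k.
apply/eqP; rewrite mulf_eq0 -[_ || _]negbK negb_or.
by apply/negP => /andP.
Qed.

Lemma rcf_seq a : row_column_finite a <-> exists s : nat -> seq nat,
  forall i j, a i j != 0 \/ a j i != 0 -> j \in s i.
Proof.
split=> [ha|[s hs] i]; last first.
  by split; apply/finite_setPs; exists (undup (s i)); rewrite ?undup_uniq//;
    move=> j /= aij; rewrite mem_undup; apply: hs; [left|right].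
suff /choice[s hs] : forall i, exists t : seq nat,
  forall j, a i j != 0 \/ a j i != 0 -> j \in t by exists s.
move=> i.
have [s _ sa] := row_support ha i; have [t _ ta] := col_support ha i.
by exists (s ++ t) => j [/sa|/ta]; rewrite mem_cat => ->; rewrite ?orbT.
Qed.

Lemma rcb_seq a : row_column_bounded a <-> exists N, exists s : nat -> seq nat,
  forall i, (size (s i) <= N)%N /\
    forall j, a i j != 0 \/ a j i != 0 -> j \in s i.
Proof.
split=> [[N ha]|[N [s hs]]]; last first.
  exists N => i; have [sN sa] := hs i.
  split; apply/card_leIPs; exists (undup (s i)).
  - by rewrite undup_uniq (leq_trans (size_undup _)).
  - by move=> j /= aij; rewrite mem_undup; apply: sa; left.
  - by rewrite undup_uniq (leq_trans (size_undup _)).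
  - by move=> j /= aij; rewrite mem_undup; apply: sa; right.
suff /choice[s hs] : forall i, exists t : seq nat, (size t <= N + N)%N /\
  forall j, a i j != 0 \/ a j i != 0 -> j \in t by exists (N + N)%N, s.
move=> i.
have [/card_leIPs[s [_ sN] sa] /card_leIPs[t [_ tN] ta]] := ha i.
exists (s ++ t); split; first by rewrite size_cat leq_add.
by move=> j [/sa|/ta]; rewrite mem_cat => ->; rewrite ?orbT.
Qed.

Lemma lin_support k a b i j (s t : seq nat) :
  (forall j, a i j != 0 \/ a j i != 0 -> j \in s) ->
  (forall j, b i j != 0 \/ b j i != 0 -> j \in t) ->
  (k *: a + b) i j != 0 \/ (k *: a + b) j i != 0 -> j \in s ++ t.
Proof.
move=> sa tb; rewrite mem_cat => h; apply/orP; move: h.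
have E l m : (k *: a + b) l m = k * a l m + b l m by [].
rewrite !E; have [->|] := eqVneq (a i j) 0; last first.
  by move=> ? _; left; apply: sa; left.
have [->|] := eqVneq (a j i) 0; last first.
  by move=> ? _; left; apply: sa; right.
by rewrite !mulr0 !add0r => ?; right; apply: tb.
Qed.

Lemma mul_support a b i j (s t : nat -> seq nat) :
  (forall i j, a i j != 0 \/ a j i != 0 -> j \in s i) ->
  (forall i j, b i j != 0 \/ b j i != 0 -> j \in t i) ->
  infmx_mul a b i j != 0 \/ infmx_mul a b j i != 0 ->
  j \in flatten (map t (s i)) ++ flatten (map s (t i)).
Proof.
move=> sa tb; rewrite mem_cat => -[] /infmx_mul_neq0[k [ak bk]]; apply/orP.
- left; apply/flattenP; exists (t k); last by apply: tb; left.
  by apply: map_f; apply: sa; left.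
- right; apply/flattenP; exists (s k); last by apply: sa; right.
  by apply: map_f; apply: tb; right.
Qed.

Lemma size_flatten_map (s : nat -> seq nat) (t : seq nat) M N :
  (forall i, size (s i) <= M)%N -> (size t <= N)%N ->
  (size (flatten (map s t)) <= N * M)%N.
Proof.
move=> sM; elim: t N => [|x t IH] [|N]//= tN.
by rewrite size_cat mulSn leq_add// IH.
Qed.

Lemma one_support i j :
  infmx_one i j != 0 \/ infmx_one j i != 0 -> j \in [:: i].
Proof. by have [_ [h1 h2]] := infmx_oneP i; move=> [/h1|/h2]. Qed.

Lemma row_column_finite1 : row_column_finite infmx_one.
Proof. by apply/rcf_seq; exists (fun i => [:: i]); exact: one_support. Qed.

Lemma row_column_finiteM a b : row_column_finite a -> row_column_finite b ->
  row_column_finite (infmx_mul a b).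
Proof.
move=> /rcf_seq[s sa] /rcf_seq[t tb]; apply/rcf_seq.
by eexists => i j; apply: mul_support; [exact: sa|exact: tb].
Qed.

Lemma row_column_finite_lin k a b :
  row_column_finite a -> row_column_finite b ->
  row_column_finite (k *: a + b).
Proof.
move=> /rcf_seq[s sa] /rcf_seq[t tb]; apply/rcf_seq.
exists (fun i => s i ++ t i) => i j.
by apply: lin_support; [exact: sa|exact: tb].
Qed.

Lemma row_column_finite0 : row_column_finite 0.
Proof. by apply/rcf_seq; exists (fun=> [::]) => i j [] /eqP. Qed.

Lemma row_column_bounded1 : row_column_bounded infmx_one.
Proof.
apply/rcb_seq; exists 1%N, (fun i => [:: i]) => i; split=> // j.
exact: one_support.
Qed.

Lemma row_column_boundedM a b : row_column_bounded a -> row_column_bounded b ->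
  row_column_bounded (infmx_mul a b).
Proof.
move=> /rcb_seq[N [s sa]] /rcb_seq[M [t tb]]; apply/rcb_seq.
exists (N * M + M * N)%N.
exists (fun i => flatten (map t (s i)) ++ flatten (map s (t i))) => i.
split; last first.
  by move=> j; apply: mul_support => ? ?; [apply: (sa _).2|apply: (tb _).2].
rewrite size_cat leq_add// size_flatten_map//.
- by move=> ?; apply: (tb _).1.
- by apply: (sa _).1.
- by move=> ?; apply: (sa _).1.
- by apply: (tb _).1.
Qed.

Lemma row_column_bounded_lin k a b :
  row_column_bounded a -> row_column_bounded b ->
  row_column_bounded (k *: a + b).
Proof.
move=> /rcb_seq[N [s sa]] /rcb_seq[M [t tb]]; apply/rcb_seq.
exists (N + M)%N, (fun i => s i ++ t i) => i; split.
  by rewrite size_cat leq_add// ?(sa _).1 ?(tb _).1.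
by move=> j; apply: lin_support; [apply: (sa _).2|apply: (tb _).2].
Qed.

Lemma row_column_bounded0 : row_column_bounded 0.
Proof.
by apply/rcb_seq; exists 0%N, (fun=> [::]) => i; split=> // j [] /eqP.
Qed.

Lemma row_column_boundedW a : row_column_bounded a -> row_column_finite a.
Proof.
move=> [N ha] i.
by split; apply/finite_set_leP; exists N; [apply: (ha i).1|apply: (ha i).2].
Qed.

Lemma fmeP a : finitely_many_entries a <->
  exists s : seq K, forall i j, a i j \in s.
Proof.
split=> [/finite_seqP[s sE]|[s sa]].
  exists s => i j; have : [set a ij.1 ij.2 | ij in [set: nat * nat]] (a i j).
    by exists (i, j).
  by rewrite sE.
apply: (@sub_finite_set _ _ [set` s]); last exact: finite_seq.
by move=> _ [[i j] _ <-] /=.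
Qed.

Lemma finitely_many_entries1 : finitely_many_entries infmx_one.
Proof.
apply/fmeP; exists [:: 0; 1] => i j; rewrite /infmx_one !inE.
by case: (i == j); rewrite eqxx ?orbT.
Qed.

Lemma finitely_many_entries0 : finitely_many_entries 0.
Proof. by apply/fmeP; exists [:: 0] => i j; rewrite !inE. Qed.

Lemma finitely_many_entries_lin k a b :
  finitely_many_entries a -> finitely_many_entries b ->
  finitely_many_entries (k *: a + b).
Proof.
move=> /fmeP[s sa] /fmeP[t tb]; apply/fmeP.
exists [seq k * x + y | x <- s, y <- t] => i j.
have -> : (k *: a + b) i j = k * a i j + b i j by [].
exact: (@allpairs_f _ _ _ (fun x y : K => k * x + y)).
Qed.

Lemma finitely_many_entriesM a b : row_column_bounded a ->
  finitely_many_entries a -> finitely_many_entries b ->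
  finitely_many_entries (infmx_mul a b).
Proof.
move=> /[dup] /row_column_boundedW ha [N aN] /fmeP[s sa] /fmeP[t tb].
pose P := [seq x * y | x <- s, y <- t].
pose S n := iter n (fun T : seq K => 0 :: [seq p + x | p <- P, x <- T]) [:: 0].
apply/fmeP; exists (S N) => i j.
have /card_leIPs[r [ur rN] ra] := (aN i).1.
rewrite (infmx_mul_row _ _ ur ra) {ur ra}.
elim: r N rN {aN} => [|k r IH] [|N]//= rN.
- by rewrite big_nil !inE.
- by rewrite big_nil !inE eqxx.
- rewrite big_cons inE; apply/orP; right.
  apply: (@allpairs_f _ _ _ (fun x y : K => x + y)); last exact: IH.
  exact: (@allpairs_f _ _ _ (fun x y : K => x * y)).
Qed.


Definition rcf_pred : {pred nat -> nat -> K^o} :=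
  [pred a | `[< row_column_finite a >]].

Lemma rcf_subsemimod_closed : subsemimod_closed rcf_pred.
Proof.
split=> [|k a /asboolP ha]; first split=> [|a b /asboolP ha /asboolP hb].
- by apply/asboolP; exact: row_column_finite0.
- by apply/asboolP; rewrite -[a]scale1r; exact: row_column_finite_lin.
- apply/asboolP; rewrite -[k *: a]addr0.
  exact: row_column_finite_lin ha row_column_finite0.
Qed.

HB.instance Definition _ :=
  GRing.isSubmodClosed.Build K (nat -> nat -> K^o) rcf_pred
  rcf_subsemimod_closed.

(* Row- and column-finite matrices. *)
Record rcf_matrix := RCFMatrix {
  rcf_entries :> nat -> nat -> K^o;
  _ : rcf_entries \in rcf_pred
}.

HB.instance Definition _ := [isSub for rcf_entries].
HB.instance Definition _ := [Choice of rcf_matrix by <:].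
HB.instance Definition _ := [SubChoice_isSubLmodule of rcf_matrix by <:].

Lemma rcfP (a : rcf_matrix) : row_column_finite a.
Proof. by case: a => a ha; exact/asboolP. Qed.

Definition rcf_one : rcf_matrix := RCFMatrix (asboolT row_column_finite1).
Definition rcf_mul (a b : rcf_matrix) : rcf_matrix :=
  RCFMatrix (asboolT (row_column_finiteM (rcfP a) (rcfP b))).

Lemma rcf_mulA : associative rcf_mul.
Proof. by move=> a b c; apply/val_inj/infmx_mulA; exact: rcfP. Qed.

Lemma rcf_mul1l : left_id rcf_one rcf_mul.
Proof. by move=> a; apply/val_inj/infmx_mul1l. Qed.

Lemma rcf_mul1r : right_id rcf_one rcf_mul.
Proof. by move=> a; apply/val_inj/infmx_mul1r. Qed.

Lemma rcf_mulDl : left_distributive rcf_mul +%R.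
Proof. by move=> a b c; apply: val_inj; exact: (infmx_mulDl a b (rcfP c)). Qed.

Lemma rcf_mulDr : right_distributive rcf_mul +%R.
Proof. by move=> a b c; apply: val_inj; exact: (infmx_mulDr b c (rcfP a)). Qed.

Lemma rcf_one_neq0 : rcf_one != 0.
Proof.
apply/eqP => /(congr1 (fun a : rcf_matrix => a 0%N 0%N))/eqP.
by rewrite [X in X == _]/= /infmx_one eqxx oner_eq0.
Qed.

HB.instance Definition _ := GRing.Zmodule_isNzRing.Build rcf_matrix
  rcf_mulA rcf_mul1l rcf_mul1r rcf_mulDl rcf_mulDr rcf_one_neq0.

Lemma rcf_scaleAl k (a b : rcf_matrix) : k *: (a * b) = (k *: a) * b.
Proof. by apply: val_inj; exact: (esym (infmx_mulZl k a (rcfP b))). Qed.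

HB.instance Definition _ := GRing.Lmodule_isLalgebra.Build K rcf_matrix
  rcf_scaleAl.

Lemma rcf_scaleAr k (a b : rcf_matrix) : k *: (a * b) = a * (k *: b).
Proof. by apply: val_inj; exact: (esym (infmx_mulZr k b (rcfP a))). Qed.

HB.instance Definition _ := GRing.Lalgebra_isAlgebra.Build K rcf_matrix
  rcf_scaleAr.

Lemma rcf_mulE (a b : rcf_matrix) i j :
  (a * b) i j = \sum_(k \in [set: nat]) a i k * b k j.
Proof. by []. Qed.

Definition fbb_pred : {pred rcf_matrix} :=
  [pred a : rcf_matrix |
    `[< finitely_many_entries a /\ row_column_bounded a >]].

Lemma fbb_subsemialg_closed : GRing.subsemialg_closed fbb_pred.
Proof.
have fbb0 : 0 \in fbb_pred.
  apply/asboolP; split; first exact: finitely_many_entries0.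
  exact: row_column_bounded0.
have fbb_lin k (a b : rcf_matrix) :
    a \in fbb_pred -> b \in fbb_pred -> k *: a + b \in fbb_pred.
  move=> /asboolP[fa ba] /asboolP[fb bb]; apply/asboolP.
  have -> : rcf_entries (k *: a + b) = k *: rcf_entries a + rcf_entries b by [].
  split; first exact: (finitely_many_entries_lin k fa fb).
  exact: (row_column_bounded_lin k ba bb).
split.
- apply/asboolP; split; first exact: finitely_many_entries1.
  exact: row_column_bounded1.
- by split=> // a b ha hb; rewrite -[a]scale1r; apply: fbb_lin.
- by move=> k a ha; rewrite -[k *: a]addr0; apply: fbb_lin.
- move=> a b /asboolP[fa ba] /asboolP[fb bb]; apply/asboolP.
  have -> : rcf_entries (a * b) = infmx_mul a b by [].
  split; first exact: (finitely_many_entriesM ba fa fb).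
  exact: (row_column_boundedM ba bb).
Qed.

HB.instance Definition _ :=
  GRing.isSubalgClosed.Build K rcf_matrix fbb_pred fbb_subsemialg_closed.

(* Matrices with finitely many distinct entries and boundedly many nonzero
   entries in each row and column; since the latter implies row- and
   column-finiteness, they form a subalgebra of [rcf_matrix]. *)
Record fbb_matrix := FBBMatrix {
  fbb_rcf :> rcf_matrix;
  _ : fbb_rcf \in fbb_pred
}.

HB.instance Definition _ := [isSub for fbb_rcf].
HB.instance Definition _ := [Choice of fbb_matrix by <:].
HB.instance Definition _ := [SubChoice_isSubAlgebra of fbb_matrix by <:].

Lemma fbb_mulE (a b : fbb_matrix) i j :
  (a * b) i j = \sum_(k \in [set: nat]) a i k * b k j.
Proof. by []. Qed.

Lemma fbbP (a : nat -> nat -> K^o) :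
  finitely_many_entries a -> row_column_bounded a ->
  exists b : fbb_matrix, a = b.
Proof.
move=> fa ba; have ra := asboolT (row_column_boundedW ba).
have fb : RCFMatrix ra \in fbb_pred by apply/asboolP.
by exists (FBBMatrix fb).
Qed.

End InfiniteMatrices.

Section CyclicCohomology.
Variables (K : fieldType) (A : algType K).

(* [dfwith a x] is [a] with its [i]-th component replaced by [x]. *)
Definition multilinear n (phi : ('I_n -> A) -> K) : Prop :=
  forall (a : 'I_n -> A) (i : 'I_n),
    scalar (fun x : A => phi (@dfwith _ (fun=> A) a i x)).

(* [ordS] is the cyclic successor, so the argument on the left-hand side is
   (a_1, ..., a_n, a_0). *)
Definition cyclic_functional n (phi : ('I_n.+1 -> A) -> K) : Prop :=
  forall a : 'I_n.+1 -> A, phi (fun i => a (ordS i)) = (-1) ^+ n * phi a.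

(* (a_0, ..., a_j a_{j+1}, ..., a_{n+1}) *)
Definition mul_face n (a : 'I_n.+2 -> A) (j : 'I_n.+1) : 'I_n.+1 -> A :=
  fun i => if (i < j)%N then a (widen_ord (leqnSn _) i)
           else if i == j then a (widen_ord (leqnSn _) j) * a (lift ord0 j)
           else a (lift ord0 i).

(* (a_{n+1} a_0, a_1, ..., a_n) *)
Definition last_face n (a : 'I_n.+2 -> A) : 'I_n.+1 -> A :=
  fun i => if i == ord0 then a ord_max * a ord0
           else a (widen_ord (leqnSn _) i).

Definition hochschild n (phi : ('I_n.+1 -> A) -> K) : ('I_n.+2 -> A) -> K :=
  fun a => \sum_(j < n.+1) (-1) ^+ j * phi (mul_face a j)
           + (-1) ^+ n.+1 * phi (last_face a).

(* The same faces for sequences indexed by [nat], of which only the first terms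
   matter; [nface n n.+1] is the last face. *)
Definition nface n j (a : nat -> A) : nat -> A := fun i =>
  if j == n.+1 then (if i == 0%N then a n.+1 * a 0%N else a i)
  else if (i < j)%N then a i else if i == j then a i * a i.+1 else a i.+1.

Definition onat n (a : nat -> A) : 'I_n -> A := fun i => a i.

Lemma mul_faceE n (a : nat -> A) (j : 'I_n.+1) :
  mul_face (onat a) j = onat (nface n j a).
Proof.
apply/funext => i; rewrite /mul_face /onat /nface /= ltn_eqF ?ltn_ord//.
by rewrite /bump !add1n -val_eqE/=; case: ifP => //; case: eqP => // ->.
Qed.

Lemma last_faceE n (a : nat -> A) :
  last_face (onat a) = onat (nface n n.+1 a) :> ('I_n.+1 -> A).
Proof. by apply/funext => i; rewrite /last_face /onat /nface eqxx -val_eqE. Qed.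

Lemma onatP n (a : 'I_n.+1 -> A) : exists b, a = onat b.
Proof.
exists (fun k => a (inord k)); apply/funext => i.
by rewrite /onat inord_val.
Qed.

Lemma hochschildE n (phi : ('I_n.+1 -> A) -> K) (a : nat -> A) :
  hochschild phi (onat a) =
  \sum_(0 <= j < n.+2) (-1) ^+ j * phi (onat (nface n j a)).
Proof.
rewrite big_nat_recr//= big_mkord /hochschild last_faceE; congr (_ + _).
by apply: eq_bigr => j _; rewrite mul_faceE.
Qed.

Lemma nfaceC n i j (a : nat -> A) : (i < j)%N -> (j < n.+3)%N ->
  onat (nface n i (nface n.+1 j a)) = onat (nface n j.-1 (nface n.+1 i a))
  :> ('I_n.+1 -> A).
Proof.
move=> ij jn; apply/funext => -[k kn]; rewrite /onat /=.
rewrite /nface.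
by repeat (case: ifP => ?; try (exfalso; lia)); rewrite ?mulrA //;
  repeat congr (_ * _); congr (a _); lia.
Qed.

Lemma face_cancel N (F : nat -> nat -> K) :
  (forall i j, (i < j)%N -> (j < N.+1)%N -> F j i = - F i j.-1) ->
  \sum_(0 <= j < N.+1) \sum_(0 <= i < N) F j i = 0.
Proof.
move=> HF.
rewrite (eq_bigr (fun j => \sum_(0 <= i < N | (i < j)%N) F j i +
   \sum_(0 <= i < N | ~~ (i < j)%N) F j i)); last first.
  by move=> j _; rewrite [LHS](bigID (fun i => (i < j)%N)).
rewrite big_split/= [X in _ + X]big_nat_recr//=.
rewrite [X in _ + (_ + X)]big_nat_cond [X in _ + (_ + X)]big1 ?addr0;
  last first.
  by move=> i; lia.
rewrite big_nat_recl//= [X in X + _ + _]big_pred0 ?add0r//.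
under eq_bigr do rewrite big_mkcond/=.
under [X in _ + X]eq_bigr do rewrite big_mkcond/=.
rewrite exchange_big/= -big_split/= big_nat_cond big1// => i /andP[iN _].
rewrite -big_split/= big_nat_cond big1// => j /andP[jN _].
rewrite ltnS -leqNgt; case: ifP => ij; last by rewrite addr0.
by rewrite HF ?addNr //; lia.
Qed.

Lemma hochschild_hochschild n (phi : ('I_n.+1 -> A) -> K) :
  hochschild (hochschild phi) = fun=> 0.
Proof.
apply/funext => a; have [{}a ->] := onatP a.
rewrite hochschildE.
under eq_bigr do rewrite hochschildE big_distrr/=.
apply: (face_cancel (F := fun j i => (-1) ^+ j * ((-1) ^+ i *
   phi (onat (nface n i (nface n.+1 j a)))))) => i [//|j] ij jn.
by rewrite nfaceC// /= exprS mulN1r mulNr mulrCA.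
Qed.

Lemma hochschild_cyclic n (phi : ('I_n.+1 -> A) -> K) :
  cyclic_functional phi -> cyclic_functional (hochschild phi).
Proof.
move=> phiC a; have [{}a ->] := onatP a.
pose r : nat -> A := fun k => if k == n.+1 then a 0%N else a k.+1.
have -> : (fun i : 'I_n.+2 => onat a (ordS i)) = onat r.
  apply/funext => -[i i_lt]; rewrite /onat /r /=.
  case: eqP => [->|ni]; first by rewrite modnn.
  by rewrite modn_small//; lia.
rewrite !hochschildE big_nat_recr//= big_nat_recr//= [in RHS]big_nat_recl//=.
rewrite [in RHS]big_nat_recr//=.
have rot (b c : nat -> A) :
    (forall k, (k < n)%N -> b k = c k.+1) -> b n = c 0%N ->
    phi (onat b) = (-1) ^+ n * phi (onat c).
  move=> bc bn; rewrite -phiC; congr phi; apply/funext => -[k k_lt].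
  rewrite /onat /=; have [->|kn] := eqVneq k n; first by rewrite modnn.
  by rewrite modn_small ?bc//; lia.
have E1 : phi (onat (nface n n r)) = (-1) ^+ n * phi (onat (nface n n.+1 a)).
  apply: rot => [k kn|]; rewrite /nface /r.
    by repeat (case: ifP => ?; try (exfalso; lia)).
  by repeat (case: ifP => ?; try (exfalso; lia)).
have E2 : onat (nface n n.+1 r) = onat (nface n 0 a) :> ('I_n.+1 -> A).
  apply/funext => -[k kn]; rewrite /onat /nface /r /=.
  by repeat (case: ifP => ?; try (exfalso; lia));
    repeat congr (_ * _); congr (a _); lia.
have E3 j : (j < n)%N ->
    phi (onat (nface n j r)) = (-1) ^+ n * phi (onat (nface n j.+1 a)).
  move=> jn; apply: rot => [k kn|]; rewrite /nface /r.
    by repeat (case: ifP => ?; try (exfalso; lia)).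
  by repeat (case: ifP => ?; try (exfalso; lia)).
rewrite E1 E2 !mulrDr addrC big_distrr/=; congr (_ + _).
  by rewrite expr0 mul1r.
congr (_ + _).
  rewrite big_nat_cond [RHS]big_nat_cond.
  apply: eq_bigr => j /andP[/andP[_ jn] _].
  by rewrite E3// !exprS !mulN1r !mulNr mulrN opprK mulrCA.
by rewrite !signrMK.
Qed.

Local Notation upd a i x := (@dfwith _ (fun=> A) a i x).

Lemma updE n (a : 'I_n -> A) i x j : upd a i x j = if j == i then x else a j.
Proof.
have [->|ji] := eqVneq j i; first by rewrite dfwith_in.
by rewrite dfwith_out// eq_sym.
Qed.

Lemma multilinear_slot n (phi : ('I_n -> A) -> K) (f : A -> 'I_n -> A) i :
  multilinear phi ->
  (forall x y j, j != i -> f x j = f y j) -> linear (fun x => f x i) ->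
  scalar (fun x => phi (f x)).
Proof.
move=> phiL fi fl k x y.
have E z : f z = upd (f 0) i (f z i).
  apply/funext => j; rewrite updE; case: eqVneq => [->//|ji]; exact: fi.
by rewrite E (fl k x y) phiL -!E.
Qed.

Lemma hochschild_multilinear n (phi : ('I_n.+1 -> A) -> K) :
  multilinear phi -> multilinear (hochschild phi).
Proof.
move=> phiL a i k x y; rewrite /hochschild.
have fL (j : 'I_n.+1) : scalar (fun x => phi (mul_face (upd a i x) j)).
  pose i' : 'I_n.+1 := if (i <= j)%N then inord i else inord i.-1.
  have i'E : i' = (if (i <= j)%N then i : nat else i.-1) :> nat.
    rewrite /i'; have := ltn_ord i; have := ltn_ord j.
    by case: ifP => ? ? ?; rewrite inordK//; lia.
  clearbody i'; case: leqP i'E => ij i'E.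
    apply: (multilinear_slot (i := i')) => // [u v l li|c u v].
      have {}li : (l : nat) <> i' by move=> /val_inj h; rewrite h eqxx in li.
      have ln : (l < n.+1)%N := ltn_ord l.
      rewrite /mul_face !updE -!val_eqE /= /bump /=.
      by repeat (case: ifP => ?; try (exfalso; lia)).
    rewrite /mul_face !updE -!val_eqE /= /bump /=.
    by repeat (case: ifP => ?; try (exfalso; lia));
      rewrite // ?mulrDl -?scalerAl.
  apply: (multilinear_slot (i := i')) => // [u v l li|c u v].
    have {}li : (l : nat) <> i' by move=> /val_inj h; rewrite h eqxx in li.
    have ln : (l < n.+1)%N := ltn_ord l.
    rewrite /mul_face !updE -!val_eqE /= /bump /=.
    by repeat (case: ifP => ?; try (exfalso; lia)).
  rewrite /mul_face !updE -!val_eqE /= /bump /=.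
  by repeat (case: ifP => ?; try (exfalso; lia));
    rewrite // ?mulrDr -?scalerAr.
have lL : scalar (fun x => phi (last_face (upd a i x))).
  pose i' : 'I_n.+1 := if (i == n.+1 :> nat) then ord0 else inord i.
  have i'E : i' = (if i == n.+1 :> nat then 0%N else i : nat) :> nat.
    rewrite /i'; have := ltn_ord i.
    by case: ifP => ? ?; rewrite ?inordK//; lia.
  clearbody i'; case: eqVneq i'E => ij i'E.
    apply: (multilinear_slot (i := i')) => // [u v l li|c u v].
      have {}li : (l : nat) <> i' by move=> /val_inj h; rewrite h eqxx in li.
      have ln : (l < n.+1)%N := ltn_ord l.
      rewrite /last_face !updE -!val_eqE /=.
      by repeat (case: ifP => ?; try (exfalso; lia)).
    rewrite /last_face !updE -!val_eqE /=.
    by repeat (case: ifP => ?; try (exfalso; lia));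
      rewrite // ?mulrDl -?scalerAl.
  apply: (multilinear_slot (i := i')) => // [u v l li|c u v].
    have {}li : (l : nat) <> i' by move=> /val_inj h; rewrite h eqxx in li.
    have ln : (l < n.+1)%N := ltn_ord l.
    rewrite /last_face !updE -!val_eqE /=.
    by repeat (case: ifP => ?; try (exfalso; lia)).
  rewrite /last_face !updE -!val_eqE /=.
  by repeat (case: ifP => ?; try (exfalso; lia));
    rewrite // ?mulrDr -?scalerAr.
under eq_bigr do rewrite fL mulrDr mulrCA.
rewrite lL big_split/= -big_distrr/= [in LHS]mulrDr mulrDr addrACA.
by congr (_ + _ + _); rewrite mulrCA.
Qed.

Definition cyclic_cochain_pred n : {pred ('I_n.+1 -> A) -> K} :=
  [pred phi | `[< multilinear phi /\ cyclic_functional phi >]].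

Lemma cyclic_cochain_zmod_closed n : zmod_closed (@cyclic_cochain_pred n).
Proof.
split=> [|f g /asboolP[fL fC] /asboolP[gL gC]]; apply/asboolP; split.
- by move=> a i k x y; rewrite mulr0 addr0.
- by move=> a; rewrite mulr0.
- move=> a i k x y; rewrite -[LHS]/(f _ - g _) fL gL.
  rewrite -[in RHS]/(f _ - g _) -[(f - g) (upd a i y)]/(f _ - g _).
  by rewrite mulrBr opprD addrACA.
- by move=> a; rewrite -[LHS]/(f _ - g _) fC gC -mulrBr.
Qed.

HB.instance Definition _ n := GRing.isZmodClosed.Build
  (('I_n.+1 -> A) -> K) (@cyclic_cochain_pred n)
  (@cyclic_cochain_zmod_closed n).

Record cyclic_cochain n := CyclicCochain {
  cochain_fun :> ('I_n.+1 -> A) -> K;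
  _ : cochain_fun \in @cyclic_cochain_pred n
}.

HB.instance Definition _ n := [isSub for @cochain_fun n].
HB.instance Definition _ n := [Choice of cyclic_cochain n by <:].
HB.instance Definition _ n :=
  [SubChoice_isSubZmodule of cyclic_cochain n by <:].

Lemma cyclic_cochainP n (phi : cyclic_cochain n) :
  multilinear phi /\ cyclic_functional phi.
Proof. by case: phi => phi h; exact/asboolP. Qed.

Lemma hochschild_closed n (phi : cyclic_cochain n) :
  hochschild phi \in @cyclic_cochain_pred n.+1.
Proof.
have [phiL phiC] := cyclic_cochainP phi; apply/asboolP.
by split; [exact: hochschild_multilinear|exact: hochschild_cyclic].
Qed.

Definition coboundary n (phi : cyclic_cochain n) : cyclic_cochain n.+1 :=
  CyclicCochain (hochschild_closed phi).

Lemma coboundary_zmod_morphism n : zmod_morphism (@coboundary n).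
Proof.
move=> f g; apply/val_inj/funext => a.
rewrite -[RHS]/(hochschild f a - hochschild g a) /= /hochschild.
rewrite opprD addrACA -sumrB -mulrBr; congr (_ + _).
by apply: eq_bigr => j _; rewrite -mulrBr.
Qed.

HB.instance Definition _ n := GRing.isZmodMorphism.Build
  (cyclic_cochain n) (cyclic_cochain n.+1) (@coboundary n)
  (@coboundary_zmod_morphism n).

Lemma coboundary_coboundary n (phi : cyclic_cochain n) :
  coboundary (coboundary phi) = 0.
Proof. by apply/val_inj; exact: hochschild_hochschild. Qed.

Definition cocycle_pred n : {pred cyclic_cochain n} :=
  [pred phi | coboundary phi == 0].

Lemma cocycle_zmod_closed n : zmod_closed (@cocycle_pred n).
Proof.
split=> [|f g /eqP f0 /eqP g0]; apply/eqP; first exact: raddf0.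
by rewrite coboundary_zmod_morphism f0 g0 subrr.
Qed.

HB.instance Definition _ n := GRing.isZmodClosed.Build
  (cyclic_cochain n) (@cocycle_pred n) (@cocycle_zmod_closed n).

Record cyclic_cocycle n := CyclicCocycle {
  cocycle_cochain :> cyclic_cochain n;
  _ : cocycle_cochain \in @cocycle_pred n
}.

HB.instance Definition _ n := [isSub for @cocycle_cochain n].
HB.instance Definition _ n := [Choice of cyclic_cocycle n by <:].
HB.instance Definition _ n :=
  [SubChoice_isSubZmodule of cyclic_cocycle n by <:].

(* There are no cochains in degree -1. *)
Definition is_coboundary n : cyclic_cochain n -> Prop :=
  match n with
  | 0 => fun phi => phi = 0
  | m.+1 => fun phi => exists psi : cyclic_cochain m, phi = coboundary psi
  end.

Definition coboundary_pred n : {pred cyclic_cocycle n} :=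
  [pred z : cyclic_cocycle n | `[< is_coboundary z >]].

Lemma coboundary_zmod_closed n : zmod_closed (@coboundary_pred n).
Proof.
split=> [|f g /asboolP hf /asboolP hg]; apply/asboolP.
  by case: n => [|n]//=; exists 0; rewrite raddf0.
have cB : cocycle_cochain (f - g) = cocycle_cochain f - cocycle_cochain g.
  exact: (raddfB val).
rewrite cB; case: n f g hf hg {cB} => [|n] f g /=.
  by move=> -> ->; rewrite subrr.
by move=> [u ->] [v ->]; exists (u - v); rewrite coboundary_zmod_morphism.
Qed.

HB.instance Definition _ n := GRing.isZmodClosed.Build
  (cyclic_cocycle n) (@coboundary_pred n) (@coboundary_zmod_closed n).

(* Cocycles modulo coboundaries, as a quotient of additive groups. *)
Definition cyclic_cohomology n := Quotient.quot (@coboundary_pred n).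

Lemma cyclic_cohomology_eq0 n :
  (forall x : cyclic_cohomology n, x = 0) <->
  (forall phi : cyclic_cochain n, coboundary phi = 0 -> is_coboundary phi).
Proof.
pose H := Quotient.quot (@coboundary_pred n).
have piE0 z : (\pi_H z == 0 :> H)%qT = (z \in @coboundary_pred n).
  by rewrite -(raddf0 \pi_H%qT) -Quotient.idealrBE subr0.
split=> [H0 phi /eqP zphi|H0 x].
  by have /eqP := H0 (\pi_H (CyclicCocycle zphi))%qT; rewrite piE0 => /asboolP.
rewrite -[x]reprK; apply/eqP; rewrite piE0; apply/asboolP/H0.
by case: (repr x) => phi zphi; exact/eqP.
Qed.

End CyclicCohomology.

(* Main.v *)
(* Both algebras A carry an endomorphism phi, sending a matrix to the block
   diagonal matrix of infinitely many copies of it, and elements s0, s1, t0, t1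
   with ti * sj = delta_ij and phi x = s0 * x * t0 + s1 * phi x * t1.

   The last identity splits f (phi a0, ..., phi an) as
     f (s0 * a0 * t0, phi a1, ..., phi an)
     + f (s1 * phi a0 * t1, phi a1, ..., phi an).
   Since phi x * s0 = s0 * x and t0 * phi x = x * t0, and likewise for s1 and t1
   with phi x in place of x, the tuples
     (a0 * t0, phi a1, ..., phi aj, s0, a(j+1), ..., an)
   give a simplicial homotopy from f to the first summand, and similarly one
   from f o phi to the second. Hence every Hochschild cocycle f, cyclic or not,
   is b of something.

   Cyclic cohomology then vanishes by induction on the degree: if f is a cyclic
   cocycle and f = b psi, then (1 - lambda) psi is a b'-cocycle, so it is b' chi,
   and N chi is a cyclic cocycle two degrees below f. Writing N chi = b N eta,
   the cochain chi - b' eta lies in ker N = im (1 - lambda), say it is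
   (1 - lambda) theta, and psi - b theta is a cyclic primitive of f. *)

From HB Require Import structures.
From Stdlib Require Cantor.
From mathcomp Require Import all_boot all_order all_algebra zify.
From mathcomp Require Import boolp functions.
From mathcomp Require Import reals complex.
Require Import Defs.
Set Implicit Arguments.
Unset Strict Implicit.
Unset Printing Implicit Defensive.
Import GRing.Theory.
Local Open Scope ring_scope.

(** * Multilinear cochains on sequences and their faces *)

Section Cochains.
Variables (K : fieldType) (A : algType K).
Implicit Types (k : K) (x y z : A) (a b c : nat -> A) (f g : (nat -> A) -> K^o).

(** A relation between three values rather than an update of one entry, so that it passes through
    products and reindexings slot by slot. [e] marks the slot being varied. *)
Definition affine_if (e : bool) k x y z : Prop :=
  if e then z = k *: x + y else z = x /\ z = y.

Definition slotwise n i k a b c : Prop :=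
  forall j, (j <= n)%N -> affine_if (j == i) k (a j) (b j) (c j).

(* Cochains of degree [n] are modelled as functionals on infinite sequences that
   only depend on the entries [0, ..., n]; for [k = 0] and [a = b] this
   condition contains that requirement, see [multilin_local]. *)
Definition multilin n f : Prop := forall i k a b c, (i <= n)%N ->
  slotwise n i k a b c -> f c = k * f a + f b.

Lemma multilin_local n f a b : multilin n f ->
  (forall i, (i <= n)%N -> a i = b i) -> f a = f b.
Proof.
move=> fL ab; rewrite (fL 0%N 0 b b a)// ?mul0r ?add0r// => j jn.
by rewrite /affine_if ab// scale0r add0r; case: ifP.
Qed.

Lemma multilin_lin n k f g : multilin n f -> multilin n g ->
  multilin n (k *: f + g).
Proof.
move=> fL gL i l a b c i_n abc.
have E d : (k *: f + g) d = k * f d + g d by [].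
rewrite !E (fL _ _ _ _ _ i_n abc) (gL _ _ _ _ _ i_n abc).
by rewrite !mulrDr addrACA [k * (l * _)]mulrCA.
Qed.

Lemma multilin0 n : multilin n 0.
Proof. by move=> i k a b c _ _; rewrite mulr0 addr0. Qed.

Lemma multilinD n f g : multilin n f -> multilin n g -> multilin n (f + g).
Proof. by move=> fL gL; rewrite -[f]scale1r; apply: multilin_lin. Qed.

Lemma multilinZ n k f : multilin n f -> multilin n (k *: f).
Proof.
by move=> fL; rewrite -[k *: f]addr0; apply: multilin_lin (@multilin0 n).
Qed.

Lemma multilinB n f g : multilin n f -> multilin n g -> multilin n (f - g).
Proof. by move=> fL gL; rewrite -scaleN1r addrC; apply: multilin_lin. Qed.

Lemma multilin_sum n m (F : nat -> (nat -> A) -> K^o) :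
  (forall j, (j < m)%N -> multilin n (F j)) ->
  multilin n (\sum_(j < m) F j).
Proof.
by move=> FL; elim/big_ind: _ => // [|f g|j _];
  [exact: multilin0|exact: multilinD|exact: FL].
Qed.

(** The faces, the shift, [cons1] and [insert] are all substitutions in which each input slot
    affects a single output slot, and affinely. *)
Lemma multilin_comp n m f (G : (nat -> A) -> nat -> A) : multilin n f ->
  (forall i, (i <= m)%N -> exists2 i', (i' <= n)%N &
    forall k a b c, slotwise m i k a b c -> slotwise n i' k (G a) (G b) (G c)) ->
  multilin m (fun a => f (G a)).
Proof.
move=> fL GL i k a b c im abc; have [i' i'n GL'] := GL i im.
exact: fL i'n (GL' _ _ _ _ abc).
Qed.

Definition face n j f : (nat -> A) -> K^o :=
  fun a => (-1) ^+ j * f (nface n j a).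

Lemma face_linear n j : linear (face n j).
Proof.
move=> k f g; apply/funext => a.
by rewrite /face -[(k *: f + g) _]/(k * f _ + g _) mulrDr mulrCA.
Qed.

HB.instance Definition _ n j := GRing.isLinear.Build K ((nat -> A) -> K^o)
  ((nat -> A) -> K^o) *:%R (face n j) (@face_linear n j).

(** The marks must not coincide, since a product of two varying factors would be quadratic. *)
Lemma affine_ifM e e' k x y z x' y' z' : ~~ (e && e') ->
  affine_if e k x y z -> affine_if e' k x' y' z' ->
  affine_if (e || e') k (x * x') (y * y') (z * z').
Proof.
case: e e' => [] [] //= _; rewrite /affine_if.
- by move=> zE [E1 E2]; rewrite zE mulrDl scalerAl {1}E1 -E2 -E1.
- by move=> [E1 E2] ->; rewrite mulrDr scalerAr {1}E1 -E2 -E1.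
- by move=> [E1 E2] [E3 E4]; rewrite -E1 -E2 -E3 -E4.
Qed.

Lemma multilin_face n j f : (j <= n.+1)%N -> multilin n f ->
  multilin n.+1 (face n j f).
Proof.
move=> jn fL; apply: multilinZ; apply: multilin_comp fL _ => i i_n.
(* The output slot fed by entry [i]: the last face merges [n.+1] into 0, any other face merges
   [j.+1] into [j]. *)
exists (if j == n.+1 then (if i == n.+1 then 0 else i)
        else if i <= j then i else i.-1)%N.
  by repeat (case: ifP => ?); lia.
move=> k a b c H l ln; rewrite /nface.
case: (eqVneq j n.+1) => [jE|jne] /=.
  case: (eqVneq l 0%N) => [->|l0].
    have -> : (0%N == if i == n.+1 then 0%N else i) = (n.+1 == i) || (0%N == i).
      by case: ifP; lia.
    by apply: affine_ifM; [lia|apply: H; lia|apply: H; lia].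
  have -> : (l == if i == n.+1 then 0%N else i) = (l == i).
    by case: ifP; lia.
  by apply: H; lia.
case: (ltnP l j) => lj.
  have -> : (l == if (i <= j)%N then i else i.-1) = (l == i).
    by case: ifP; lia.
  by apply: H; lia.
case: (eqVneq l j) => lj'.
  have -> : (l == if (i <= j)%N then i else i.-1) = (l == i) || (l.+1 == i).
    by case: ifP; lia.
  by apply: affine_ifM; [lia|apply: H; lia|apply: H; lia].
have -> : (l == if (i <= j)%N then i else i.-1) = (l.+1 == i).
  by case: ifP; lia.
by apply: H; lia.
Qed.

(** * The cyclic operator and its commutation with faces *)

Definition backshift n a : nat -> A :=
  fun i => if i == 0%N then a n else a i.-1.

Lemma iter_backshift n i a m : (m <= n)%N -> (i <= n.+1)%N ->
  iter i (backshift n) a m =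
  if (i <= m)%N then a (m - i)%N else a (m + n.+1 - i)%N.
Proof.
elim: i m => [|i IH] m mn i_n; first by rewrite subn0.
rewrite iterS {1}/backshift; case: eqP => [->|m0]; rewrite IH; try lia.
  by rewrite add0n subSS ltn0 -ltnS i_n.
have -> : (i <= m.-1)%N = (i < m)%N by lia.
by case: ifP => _; congr (a _); lia.
Qed.

(* Powers of Connes' cyclic operator, acting on cochains of degree [n]. *)
Definition lam n i f : (nat -> A) -> K^o :=
  fun a => (-1) ^+ (n * i) * f (iter i (backshift n) a).

Lemma lam_linear n i : linear (lam n i).
Proof.
move=> k f g; apply/funext => a.
by rewrite /lam -[(k *: f + g) _]/(k * f _ + g _) mulrDr mulrCA.
Qed.

HB.instance Definition _ n i := GRing.isLinear.Build K ((nat -> A) -> K^o)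
  ((nat -> A) -> K^o) *:%R (lam n i) (@lam_linear n i).

Lemma lam0 n f : lam n 0 f = f.
Proof. by apply/funext => a; rewrite /lam muln0 mul1r. Qed.

Lemma lamD n i j f : lam n i (lam n j f) = lam n (i + j) f.
Proof.
by apply/funext => a; rewrite /lam mulrA -exprD -mulnDr [(i + j)%N]addnC iterD.
Qed.

(** The sign is trivial because [n * n.+1] is even, and [n.+1] rotations restore the entries that
    [f] sees. *)
Lemma lam_order n f : multilin n f -> lam n n.+1 f = f.
Proof.
move=> fL; apply/funext => a; rewrite /lam -signr_odd oddM oddS andbN mul1r.
apply: (multilin_local fL) => i i_n; rewrite iter_backshift// ltnNge i_n/=.
by rewrite addnK.
Qed.

Lemma multilin_lam n i f : multilin n f -> multilin n (lam n i f).
Proof.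
move=> fL; elim: i => [|i IH]; first by rewrite lam0.
rewrite -add1n -lamD; apply: multilinZ; apply: multilin_comp IH _ => l ln.
exists (if l == n then 0 else l.+1)%N; first by case: ifP; lia.
move=> k a b c H j jn; rewrite /= /backshift; case: (eqVneq j 0%N) => [->|j0].
  have -> : (0%N == if l == n then 0%N else l.+1) = (n == l).
    by case: ifP; lia.
  by apply: H; lia.
have -> : (j == if l == n then 0%N else l.+1) = (j.-1 == l).
  by case: ifP; lia.
by apply: H; lia.
Qed.

Lemma lam_faceS n j f : (j <= n)%N -> multilin n f ->
  lam n.+1 1 (face n j.+1 f) = face n j (lam n 1 f).
Proof.
move=> jn fL; apply/funext => a; rewrite /lam /face /= !mulrA -!exprD.
congr (_ * _).
  by rewrite -signr_odd -[RHS]signr_odd; congr (_ ^+ _); lia.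
apply: (multilin_local fL) => i i_n; rewrite /nface /backshift /=.
by repeat (case: ifP => ?; try (exfalso; lia)); repeat congr (_ * _);
  congr (a _); lia.
Qed.

Lemma lam_face0 n f : multilin n f -> lam n.+1 1 (face n 0 f) = face n n.+1 f.
Proof.
move=> fL; apply/funext => a; rewrite /lam /face /= mul1r muln1.
congr (_ * _).
apply: (multilin_local fL) => i i_n; rewrite /nface /backshift /=.
by repeat (case: ifP => ?; try (exfalso; lia)); repeat congr (_ * _);
  congr (a _); lia.
Qed.

Lemma lam_face n j f : (j <= n.+1)%N -> multilin n f ->
  lam n.+1 j (face n j f) = face n 0 (lam n j f).
Proof.
elim: j f => [|j IH] f jn fL; first by rewrite !lam0.
transitivity (lam n.+1 j (lam n.+1 1 (face n j.+1 f))).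
  by rewrite lamD addn1.
rewrite lam_faceS// IH ?lamD ?addn1//; first lia.
exact: multilin_lam.
Qed.

(** * The norm operator and Connes' [b] and [b'] *)

Definition norm n f := \sum_(i < n.+1) lam n i f.

Lemma norm_linear n : linear (norm n).
Proof.
move=> k f g; rewrite /norm scaler_sumr -big_split/=.
by apply: eq_bigr => i _; rewrite linearP.
Qed.

HB.instance Definition _ n := GRing.isLinear.Build K ((nat -> A) -> K^o)
  ((nat -> A) -> K^o) *:%R (norm n) (@norm_linear n).

Lemma multilin_norm n f : multilin n f -> multilin n (norm n f).
Proof.
move=> fL; apply: (multilin_sum (F := fun j => lam n j f)) => j _.
exact: multilin_lam.
Qed.

Lemma normE n f : multilin n f -> norm n f = \sum_(i < n.+1) lam n i.+1 f.
Proof.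
move=> fL; rewrite /norm big_ord_recl [RHS]big_ord_recr /= lam_order// lam0.
by rewrite addrC; congr (_ + _); apply: eq_bigr.
Qed.

Lemma lam_norm n i f : multilin n f -> lam n i (norm n f) = norm n f.
Proof.
move=> fL; have E : lam n 1 (norm n f) = norm n f.
  by rewrite [RHS]normE// linear_sum/=; apply: eq_bigr => j _;
    rewrite lamD add1n.
by elim: i => [|i IH]; rewrite ?lam0// -addn1 -lamD E.
Qed.

Lemma norm_lam n i f : multilin n f -> norm n (lam n i f) = norm n f.
Proof.
move=> fL; rewrite -(lam_norm i fL) /norm [in RHS]linear_sum/=.
by apply: eq_bigr => j _; rewrite !lamD addnC.
Qed.

Lemma norm_fixed n f : lam n 1 f = f -> norm n f = n.+1%:R *: f.
Proof.
move=> f1; have fi i : lam n i f = f.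
  by elim: i => [|i IH]; rewrite ?lam0// -add1n -lamD IH.
by rewrite /norm (eq_bigr (fun=> f))// sumr_const card_ord scaler_nat.
Qed.

(* [dsum n n.+2] is Connes' [b] and [dsum n n.+1] is [b']. *)
Definition dsum n m f := \sum_(j < m) face n j f.

Lemma dsum_linear n m : linear (dsum n m).
Proof.
move=> k f g; rewrite /dsum scaler_sumr -big_split/=.
by apply: eq_bigr => i _; rewrite linearP.
Qed.

HB.instance Definition _ n m := GRing.isLinear.Build K ((nat -> A) -> K^o)
  ((nat -> A) -> K^o) *:%R (dsum n m) (@dsum_linear n m).

Lemma multilin_dsum n m f : (m <= n.+2)%N -> multilin n f ->
  multilin n.+1 (dsum n m f).
Proof.
move=> mn fL; apply: (multilin_sum (F := fun j => face n j f)) => j jm.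
by apply: multilin_face => //; lia.
Qed.

Lemma dsumE n m f a :
  dsum n m f a = \sum_(0 <= j < m) (-1) ^+ j * f (nface n j a).
Proof. by rewrite /dsum fct_sumE big_mkord. Qed.

Lemma multilin_onat n f a b : multilin n f ->
  onat a = onat b :> ('I_n.+1 -> A) -> f a = f b.
Proof.
move=> fL ab; apply: (multilin_local fL) => i; rewrite -ltnS => i_n.
exact: (congr1 (fun u : 'I_n.+1 -> A => u (Ordinal i_n)) ab).
Qed.

Lemma dsum_dsum n m f : (m <= n.+2)%N -> multilin n f ->
  dsum n.+1 m.+1 (dsum n m f) = 0.
Proof.
move=> mn fL; apply/funext => a; rewrite dsumE.
under eq_bigr do rewrite dsumE big_distrr/=.
apply: (face_cancel (F := fun j i => (-1) ^+ j * ((-1) ^+ i *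
   f (nface n i (nface n.+1 j a))))) => i [//|j] ij jn.
rewrite (multilin_onat fL (nfaceC _ ij _)); last lia.
by rewrite /= exprS mulN1r mulNr mulrCA.
Qed.

(** [norm] absorbs powers of [lam], and [lam n.+1 j] carries the [j]-th face to the zeroth, so both
    sides equal [norm n.+1 (face n 0 (norm n f))]. This is N b' = b N. *)
Lemma norm_dsum n f : multilin n f ->
  norm n.+1 (dsum n n.+1 f) = dsum n n.+2 (norm n f).
Proof.
move=> fL; have nL := multilin_norm fL.
have f0L := multilin_face (leq0n _) nL.
transitivity (norm n.+1 (face n 0 (norm n f))).
  rewrite /dsum [X in face _ _ X]/norm 3!linear_sum/=.
  apply: eq_bigr => j _; have jn : (j <= n.+1)%N by have := ltn_ord j; lia.
  by rewrite -(lam_face jn fL) norm_lam//; exact: multilin_face.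
(* In reverse order, the zeroth face rotated [n.+2 - j] times is the [j]-th face, by periodicity. *)
rewrite normE// [LHS](reindex_inj rev_ord_inj)/=; apply: eq_bigr => j _.
have jn : (j <= n.+1)%N by have := ltn_ord j; lia.
rewrite subSS -[in LHS](lam_norm j fL) -(lam_face jn nL).
rewrite lamD; have -> : ((n.+1 - j).+1 + j = n.+2)%N by lia.
by rewrite lam_order//; exact: multilin_face.
Qed.

Lemma dsumS n f : dsum n n.+2 f = dsum n n.+1 f + face n n.+1 f.
Proof. by rewrite /dsum big_ord_recr. Qed.

(** [lam] turns faces 1 to n+1 of [f] into faces 0 to n of [lam n 1 f], and face 0 into the last
    face, which cancels. This is (1 - lambda) b = b' (1 - lambda). *)
Lemma lam_dsum n f : multilin n f ->
  dsum n n.+2 f - lam n.+1 1 (dsum n n.+2 f) = dsum n n.+1 (f - lam n 1 f).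
Proof.
move=> fL; rewrite linearB/= {2}/dsum big_ord_recl linearD/= lam_face0//.
rewrite dsumS linear_sum/= (eq_bigr (fun j : 'I_n.+1 => face n j (lam n 1 f))).
  by rewrite addrKA.
by move=> j _; rewrite lam_faceS//; have := ltn_ord j; lia.
Qed.

Lemma norm_ker n f : (n.+1%:R : K) != 0 -> multilin n f -> norm n f = 0 ->
  exists2 g, multilin n g & f = g - lam n 1 g.
Proof.
move=> nN0 fL f0.
(* Telescoping gives (1 - lambda) g = N f - (n+1) f, hence the division by -(n+1). *)
pose g := \sum_(i < n.+1) i%:R *: lam n i f.
have gL : multilin n g.
  apply: (multilin_sum (F := fun i => i%:R *: lam n i f)) => i _.
  exact/multilinZ/multilin_lam.
exists (- n.+1%:R^-1 *: g); first exact: multilinZ.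
have gE : g - lam n 1 g = - n.+1%:R *: f.
  rewrite /g linear_sum/= [X in _ - X]big_ord_recr/= big_ord_recl/=.
  rewrite scale0r add0r.
  rewrite [lam n 1 (_ *: lam n n f)]linearZ/= lamD add1n lam_order//.
  rewrite opprD addrA -sumrB.
  rewrite (eq_bigr (fun i : 'I_n => lam n i.+1 f)); last first.
    move=> i _; rewrite [lam n 1 (_ *: _)]linearZ/= lamD !add1n -scalerBl.
    by rewrite -natrB// subSnn scale1r.
  move: f0; rewrite normE// big_ord_recr/= lam_order// => /eqP.
  rewrite addr_eq0 => /eqP ->.
  by rewrite scaleNr -addn1 natrD scalerDl scale1r opprD addrC.
rewrite [lam n 1 (_ *: g)]linearZ/= -scalerBr gE scalerA mulrNN.
by rewrite mulVf// scale1r.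
Qed.

(** * Contractibility of the [b'] complex *)

Definition cons1 a : nat -> A := fun i => if i is i'.+1 then a i' else 1.

(** Prepending 1 is a contraction: face 0 of [cons1 a] is [a], and face [j.+1] is [cons1] of face
    [j] for [j <= n]. *)
Lemma dsum_contraction n f : multilin n.+1 f -> dsum n.+1 n.+2 f = 0 ->
  exists2 g, multilin n g & f = dsum n n.+1 g.
Proof.
move=> fL f0; exists (fun a => f (cons1 a)).
  apply: multilin_comp fL _ => i i_n; exists i.+1 => // k a b c H [|j] jn //=.
  exact: H.
apply/funext => a; rewrite dsumE.
have : dsum n.+1 n.+2 f (cons1 a) = 0 by rewrite f0.
rewrite dsumE big_nat_recl// expr0 mul1r.
have -> : f (nface n.+1 0 (cons1 a)) = f a.
  apply: (multilin_local fL) => -[|i] _ //=; exact: mul1r.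
move/eqP; rewrite addr_eq0 => /eqP ->.
rewrite -sumrN big_nat_cond [RHS]big_nat_cond.
apply: eq_bigr => j /andP[/andP[_ jn] _].
rewrite exprS mulN1r mulNr opprK; congr (_ * _).
apply: (multilin_local fL) => -[|i] i_n; rewrite /nface //=;
  by repeat (case: ifP => ?; try (exfalso; lia)).
Qed.

Lemma dsum0_inj f : multilin 0 f -> dsum 0 1 f = 0 -> f = 0.
Proof.
move=> fL f0; apply/funext => a.
have : dsum 0 1 f (cons1 a) = 0 by rewrite f0.
rewrite dsumE big_nat1 mul1r => E; rewrite -[RHS]E.
by apply: (multilin_local fL) => -[|//] _; rewrite /nface /= mul1r.
Qed.

End Cochains.

(** * Simplicial homotopies of Hochschild cochains *)

(** [G j i] stands for the [i]-th face of the [j]-th insertion, [E j i] for the [j]-th insertion of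
    the [i]-th face. The terms at [i = j] and [i = j.+1] telescope to the two end terms. *)
Lemma homotopy_cancel (K : pzRingType) N (G E : nat -> nat -> K) :
  (forall j, (j < N)%N -> G j j.+1 = G j.+1 j.+1) ->
  (forall i j, (i < j)%N -> (j <= N)%N -> G j i = E j.-1 i) ->
  (forall i j, (j.+1 < i)%N -> (i <= N.+1)%N -> G j i = E j i.-1) ->
  \sum_(0 <= j < N.+1) (-1) ^+ j * \sum_(0 <= i < N.+2) (-1) ^+ i * G j i =
  G 0%N 0%N - G N N.+1
  - \sum_(0 <= j < N) (-1) ^+ j * \sum_(0 <= i < N.+1) (-1) ^+ i * E j i.
Proof.
move=> Gdiag Glow Ghigh.
have row j : (j < N.+1)%N ->
    (-1) ^+ j * (\sum_(0 <= i < N.+2) (-1) ^+ i * G j i) =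
    (G j j - G j j.+1)
    + (-1) ^+ j * (\sum_(0 <= i < j) (-1) ^+ i * E j.-1 i)
    - (-1) ^+ j * (\sum_(j.+1 <= i < N.+1) (-1) ^+ i * E j i).
  move=> jN; rewrite (big_cat_nat (n := j))//=; last lia.
  rewrite [X in _ + X]big_ltn; last lia.
  rewrite [X in _ + (_ + X)]big_ltn; last lia.
  rewrite (@eq_big_nat _ _ _ 0%N j _ (fun i => (-1) ^+ i * E j.-1 i)).
    rewrite [X in _ + (_ + (_ + X))]big_add1/=.
    rewrite (@eq_big_nat _ _ _ j.+1 N.+1 _ (fun i => - ((-1) ^+ i * E j i))).
      rewrite sumrN addrA !mulrDr mulrN signrMK exprS mulN1r mulNr mulrN signrMK.
      by rewrite addrA; congr (_ - _); rewrite -addrA addrC.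
    by move=> i ij; rewrite Ghigh ?exprS ?mulN1r ?mulNr//; lia.
  by move=> i ij; rewrite Glow//; lia.
rewrite (@eq_big_nat _ _ _ 0%N N.+1 _ _ row) sumrB big_split/=.
have -> : \sum_(0 <= j < N.+1) (G j j - G j j.+1) = G 0%N 0%N - G N N.+1.
  rewrite sumrB big_nat_recl// [X in _ - X]big_nat_recr//=.
  rewrite (@eq_big_nat _ _ _ 0%N N _ _ Gdiag) opprD addrA.
  by rewrite addrK.
rewrite -addrA; congr (_ + _).
(* The low part of row 0 and the high part of row [N] are empty; the low part of row [j.+1] and the
   high part of row [j] make up the full sum over [E j]. *)
rewrite big_nat_recl// big_nil mulr0 add0r.
rewrite [X in _ - X]big_nat_recr//= [X in _ - (_ + _ * X)]big_geq// mulr0 addr0.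
rewrite -sumrB -sumrN; apply: eq_big_nat => j jN.
rewrite [in RHS](big_cat_nat (n := j.+1))//=; last lia.
by rewrite exprS mulN1r mulNr mulrDr opprD.
Qed.

Section HochschildHomotopy.
Variables (K : fieldType) (A : algType K).
Implicit Types (k : K) (x y z : A) (a b c : nat -> A) (f g : (nat -> A) -> K^o).

Lemma affine_if_linear (h : A -> A) e k x y z : linear h ->
  affine_if e k x y z -> affine_if e k (h x) (h y) (h z).
Proof.
by case: e => hL; rewrite /affine_if; [move=> ->; exact: hL|move=> [-> ->]].
Qed.

Variables (rho sigma : A -> A) (s t : A).
Hypotheses (rhoL : linear rho) (sigmaL : linear sigma).
Hypotheses (rhoM : {morph rho : x y / x * y})
  (sigmaM : {morph sigma : x y / x * y}).
Hypotheses (rho_s : forall x, rho x * s = s * sigma x)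
  (t_rho : forall x, t * rho x = sigma x * t) (ts : t * s = 1).

(** With [rho = phi], the two homotopies are the cases [sigma = idfun], with [s0] and [t0], and
    [sigma = phi], with [s1] and [t1]. *)
Definition insert j a : nat -> A := fun i =>
  if i == 0%N then sigma (a 0%N) * t else
  if (i <= j)%N then rho (a i) else
  if i == j.+1 then s else sigma (a i.-1).

Definition homotopy n f : (nat -> A) -> K^o :=
  \sum_(j < n.+1) fun a => (-1) ^+ j * f (insert j a).

Lemma multilin_homotopy n f : multilin n.+1 f -> multilin n (homotopy n f).
Proof.
move=> fL.
apply: (multilin_sum (F := fun j a => (-1) ^+ j * f (insert j a))) => j jn.
apply: multilinZ; apply: multilin_comp fL _ => i i_n.
(* Entries after [j] move up past [s], except entry 0, which stays; slot [j.+1] holds the constant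
   [s] and is never hit. *)
exists (if i == 0 then 0 else if i <= j then i else i.+1)%N.
  by repeat (case: ifP => ?); lia.
move=> k a b c H l ln; rewrite /insert; case: (eqVneq l 0%N) => [->|l0].
  have -> : (0%N == if i == 0%N then 0%N else if (i <= j)%N then i else i.+1) =
    (0%N == i) by repeat (case: ifP => ?); lia.
  apply: (affine_if_linear (h := fun x => sigma x * t)); last exact: H.
  by move=> l' x y; rewrite sigmaL mulrDl scalerAl.
case: (leqP l j) => lj.
  have -> : (l == if i == 0%N then 0%N else if (i <= j)%N then i else i.+1) =
    (l == i) by repeat (case: ifP => ?); lia.
  by apply: affine_if_linear => //; apply: H; lia.
case: (eqVneq l j.+1) => lj'.
  have -> // : (l == if i == 0%N then 0%N else if (i <= j)%N then i else i.+1) =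
    false by repeat (case: ifP => ?); lia.
have -> : (l == if i == 0%N then 0%N else if (i <= j)%N then i else i.+1) =
  (l.-1 == i) by repeat (case: ifP => ?); lia.
by apply: affine_if_linear => //; apply: H; lia.
Qed.

Lemma homotopyE n f a :
  homotopy n f a = \sum_(0 <= j < n.+1) (-1) ^+ j * f (insert j a).
Proof. by rewrite /homotopy fct_sumE big_mkord. Qed.

(* The last sum is [dsum n.-1 n.+1 (homotopy n.-1 f) a] when [0 < n], see
   [dsum_homotopy]; it is written out because it must vanish when [n = 0]. *)
Lemma homotopy_dsum n f a : multilin n f ->
  homotopy n (dsum n n.+2 f) a =
  f (fun i => sigma (a i))
  - f (fun i => if i == 0%N then s * (sigma (a 0%N) * t) else rho (a i))
  - \sum_(0 <= j < n) (-1) ^+ j *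
      \sum_(0 <= i < n.+1) (-1) ^+ i * f (insert j (nface n.-1 i a)).
Proof.
move=> fL; rewrite homotopyE.
under eq_bigr do rewrite dsumE.
have loc := multilin_local fL.
rewrite (@homotopy_cancel _ n (fun j i => f (nface n i (insert j a)))
  (fun j i => f (insert j (nface n.-1 i a)))).
(* [G 0 0] closes up by [t * s = 1]; [G n n.+1] is the last face, which wraps [s] around to the
   front. *)
- congr (_ - _ - _); apply: loc => i i_n; rewrite /nface /insert.
    by repeat (case: ifP => ?; try (exfalso; lia)); rewrite -?mulrA ?ts ?mulr1;
      repeat congr (_ * _); repeat congr (sigma _); congr (a _); lia.
  by repeat (case: ifP => ?; try (exfalso; lia)); rewrite //;
    congr (rho (a _)); lia.
- move=> j jn; apply: loc => l ln; rewrite /nface /insert.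
  by repeat (case: ifP => ?; try (exfalso; lia)); rewrite ?rho_s//;
    repeat congr (sigma _); repeat congr (rho _); congr (a _); lia.
(* For [i = 0] the factor [t] has to move past [rho (a 1)]. *)
- move=> i j ij jn; apply: loc => l ln; rewrite /nface /insert.
  by repeat (case: ifP => ?; try (exfalso; lia));
    rewrite ?rhoM ?sigmaM -?mulrA ?t_rho//; repeat congr (_ * _);
    repeat congr (sigma _); repeat congr (rho _); congr (a _); lia.
- move=> i j ij jn; apply: loc => l ln; rewrite /nface /insert.
  by repeat (case: ifP => ?; try (exfalso; lia));
    rewrite ?rhoM ?sigmaM -?mulrA ?t_rho//; repeat congr (_ * _);
    repeat congr (sigma _); repeat congr (rho _); congr (a _); lia.
Qed.

Lemma homotopy0 n a : homotopy n 0 a = 0.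
Proof. by rewrite homotopyE big1// => j _; rewrite mulr0. Qed.

Lemma dsum_homotopy n f a : dsum n n.+2 (homotopy n f) a =
  \sum_(0 <= j < n.+1) (-1) ^+ j *
    \sum_(0 <= i < n.+2) (-1) ^+ i * f (insert j (nface n i a)).
Proof.
rewrite dsumE; under eq_bigr do rewrite homotopyE big_distrr/=.
rewrite exchange_big; apply: eq_bigr => j _; rewrite big_distrr/=.
by apply: eq_bigr => i _; rewrite mulrCA.
Qed.

End HochschildHomotopy.

(** * Vanishing of Hochschild cohomology by an infinite sum *)

Section InfiniteSum.
Variables (K : fieldType) (A : algType K).
Implicit Types (k : K) (x y z : A) (a b c : nat -> A) (f g : (nat -> A) -> K^o).

Variables (phi : A -> A) (s0 s1 t0 t1 : A).
Hypotheses (phiL : linear phi) (phiM : {morph phi : x y / x * y}).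
Hypotheses (t0s0 : t0 * s0 = 1) (t0s1 : t0 * s1 = 0)
  (t1s0 : t1 * s0 = 0) (t1s1 : t1 * s1 = 1).
Hypothesis phiE : forall x, phi x = s0 * x * t0 + s1 * phi x * t1.

Let phi_s0 x : phi x * s0 = s0 * x.
Proof. by rewrite phiE mulrDl -!mulrA t0s0 t1s0 !mulr0 addr0 mulr1. Qed.

Let t0_phi x : t0 * phi x = x * t0.
Proof. by rewrite phiE mulrDr !mulrA t0s0 t0s1 !mul0r addr0 mul1r. Qed.

Let phi_s1 x : phi x * s1 = s1 * phi x.
Proof. by rewrite {1}phiE mulrDl -!mulrA t0s1 t1s1 !mulr0 add0r mulr1. Qed.

Let t1_phi x : t1 * phi x = phi x * t1.
Proof. by rewrite {1}phiE mulrDr !mulrA t1s0 t1s1 !mul0r add0r mul1r. Qed.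

Let idM : {morph @idfun A : x y / x * y}. Proof. by []. Qed.

Let phi_id_homotopy :=
  @homotopy_dsum K A phi idfun s0 t0 phiM idM phi_s0 t0_phi t0s0.
Let phi_phi_homotopy :=
  @homotopy_dsum K A phi phi s1 t1 phiM phiM phi_s1 t1_phi t1s1.

Let phi_split n f a : multilin n f ->
  f (fun i => phi (a i)) =
  f (fun i => if i == 0%N then s0 * (a 0%N * t0) else phi (a i)) +
  f (fun i => if i == 0%N then s1 * (phi (a 0%N) * t1) else phi (a i)).
Proof.
move=> fL; rewrite -[X in X + _]mul1r; apply: (fL 0%N) => // -[|j] _ //=.
by rewrite /affine_if/= scale1r !mulrA -phiE.
Qed.

(** In the sum of the two homotopy identities, the value at [phi a] cancels against its two parts
    from [phi_split]. *)
Let cocycle_expansion n f a : multilin n f -> dsum n n.+2 f = 0 ->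
  f a = \sum_(0 <= j < n) (-1) ^+ j * \sum_(0 <= i < n.+1) (-1) ^+ i *
      f (insert phi idfun s0 t0 j (nface n.-1 i a)) +
    \sum_(0 <= j < n) (-1) ^+ j * \sum_(0 <= i < n.+1) (-1) ^+ i *
      f (insert phi phi s1 t1 j (nface n.-1 i a)).
Proof.
move=> fL f0; have := phi_id_homotopy a fL; have := phi_phi_homotopy a fL.
rewrite f0 !homotopy0 (phi_split a fL) addrK => /esym/eqP.
rewrite subr_eq0 => /eqP <- /esym/eqP; rewrite -addrA -opprD subr_eq0.
by rewrite addrC => /eqP.
Qed.

Lemma hochschild_acyclic0 f : multilin 0 f -> dsum 0 2 f = 0 -> f = 0.
Proof.
move=> fL f0; apply/funext => a; rewrite (cocycle_expansion a fL f0).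
(* In degree 0 both sums are empty. *)
by rewrite !big_geq// addr0.
Qed.

Lemma hochschild_acyclicS n f : multilin n.+1 f -> dsum n.+1 n.+3 f = 0 ->
  exists2 g, multilin n g & f = dsum n n.+2 g.
Proof.
move=> fL f0.
exists (homotopy phi idfun s0 t0 n f + homotopy phi phi s1 t1 n f).
  by apply: multilinD; apply: multilin_homotopy.
apply/funext => a; rewrite (cocycle_expansion a fL f0) linearD/=.
by rewrite -!dsum_homotopy.
Qed.

(** * From Hochschild to cyclic vanishing *)

Hypothesis natK : forall n, (n.+1%:R : K) != 0.

Definition cyclic_coboundary n f : Prop :=
  if n is m.+1 then
    exists g, [/\ multilin m g, lam m 1 g = g & f = dsum m m.+2 g]
  else f = 0.

Lemma cyclic_acyclic n f : multilin n f -> lam n 1 f = f ->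
  dsum n n.+2 f = 0 -> cyclic_coboundary n f.
Proof.
elim/ltn_ind: n f => -[|n] IH f fL fC f0 /=; first exact: hochschild_acyclic0.
have [psi psiL fE] := hochschild_acyclicS fL f0.
(* Subtracting a Hochschild cocycle with the same image under 1 - lambda makes [psi] cyclic and
   keeps its coboundary. *)
suff [theta [thetaL theta0 thetaE]] : exists theta, [/\ multilin n theta,
    dsum n n.+2 theta = 0 & psi - lam n 1 psi = theta - lam n 1 theta].
  exists (psi - theta); split; first exact: multilinB.
    rewrite linearB/= (_ : lam n 1 psi = psi - (theta - lam n 1 theta)).
      by rewrite -addrA -opprD subrK.
    by rewrite -thetaE subKr.
  by rewrite linearB/= theta0 subr0.
have psi'0 : dsum n n.+1 (psi - lam n 1 psi) = 0.
  by rewrite -lam_dsum// -fE fC subrr.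
have psi'L : multilin n (psi - lam n 1 psi).
  by apply: multilinB => //; exact: multilin_lam.
case: n => [|n] in IH f fL fC f0 psi psiL fE psi'0 psi'L *.
  (* For [f] of degree 1, [b'] is injective on the degree of [psi], so [psi] is already cyclic. *)
  exists 0; split; [exact: multilin0|exact: linear0|].
  by rewrite linear0 subrr; exact: dsum0_inj.
have [chi chiL psiE] := dsum_contraction psi'L psi'0.
have Nchi0 : dsum n n.+2 (norm n chi) = 0.
  by rewrite -norm_dsum// -psiE linearB/= norm_lam// subrr.
have NchiL := multilin_norm chiL.
have Nchi_cob := IH n (ltnW (ltnSn _)) _ NchiL (lam_norm 1 chiL) Nchi0.
(* The cocycle sought is then b theta', since (1 - lambda) b = b' (1 - lambda). *)
suff [theta' thetaL' E] : exists2 theta, multilin n theta &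
    dsum n n.+1 chi = dsum n n.+1 (theta - lam n 1 theta).
  exists (dsum n n.+2 theta'); split; first exact: multilin_dsum.
    exact: dsum_dsum.
  by rewrite psiE E lam_dsum.
clear psiE; move: Nchi_cob.
case: n {IH f fL fC f0 psi psiL fE psi'0 psi'L} => [|n] in
  chi chiL Nchi0 NchiL *.
  (* In degree 0 the norm is the identity, so [chi] itself is 0. *)
  rewrite /= /norm big_ord1 lam0 => ->.
  exists 0; first exact: multilin0.
  by rewrite [lam _ _ 0]linear0 subr0.
move=> [eta [etaL etaC etaE]].
(* As [eta] is cyclic, N eta' = eta, so N b' eta' = b eta = N chi. *)
pose eta' := n.+1%:R^-1 *: eta.
have etaL' : multilin n eta' by exact: multilinZ.
have [|//||theta thetaL thetaE] := @norm_ker K A n.+1 (chi - dsum n n.+1 eta').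
- exact: natK.
- by apply: multilinB => //; exact: multilin_dsum.
- rewrite linearB/= norm_dsum// etaE linearZ/= norm_fixed// scalerA mulVf//.
  by rewrite scale1r subrr.
(* The correction b' eta' is invisible to [b']. *)
exists theta => //; rewrite -thetaE linearB/= dsum_dsum ?subr0//.
Qed.

(** * Transfer to cochains on finite tuples *)

Lemma multilin_onatP n (u : ('I_n.+1 -> A) -> K) :
  multilinear u -> multilin n (fun a => u (onat a)).
Proof.
move=> uL i k a b c; rewrite -ltnS => i_n abc.
have {}abc j : (j < n.+1)%N -> affine_if (j == i) k (a j) (b j) (c j).
  exact: abc.
have updE d : (forall j, (j < n.+1)%N -> j != i -> d j = c j) ->
    onat d = @dfwith _ (fun=> A) (onat c) (Ordinal i_n) (d i).
  move=> dc; apply/funext => j; rewrite Defs.updE -val_eqE/= /onat.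
  by case: (eqVneq (j : nat) i) => [->//|ji]; exact: dc.
have -> : onat a = @dfwith _ (fun=> A) (onat c) (Ordinal i_n) (a i).
  by apply: updE => j /abc; rewrite /affine_if => H /negPf ji;
    move: H; rewrite ji => -[].
have -> : onat b = @dfwith _ (fun=> A) (onat c) (Ordinal i_n) (b i).
  by apply: updE => j /abc; rewrite /affine_if => H /negPf ji;
    move: H; rewrite ji => -[].
rewrite [onat c in LHS]updE//.
by have := abc i i_n; rewrite /affine_if eqxx => ->; exact: uL.
Qed.

Lemma multilinear_inord n g : multilin n g ->
  multilinear (fun u : 'I_n.+1 -> A => g (fun i => u (inord i))).
Proof.
move=> gL u i k x y; apply: (gL i) => [|j]; first by rewrite -ltnS.
rewrite -ltnS => jn; rewrite !Defs.updE -!val_eqE/= inordK//.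
by rewrite /affine_if; case: eqP.
Qed.

Theorem cyclic_cohomology_infinite_sum n (x : cyclic_cohomology A n) : x = 0.
Proof.
move: x; apply/cyclic_cohomology_eq0 => u u0; have [uL uC] := cyclic_cochainP u.
pose f : (nat -> A) -> K^o := fun a => u (onat a).
have fL : multilin n f := multilin_onatP uL.
have fC : lam n 1 f = f.
  (* The cyclic successor undoes [backshift]. *)
  apply/funext => a; rewrite /lam muln1 /f /= -uC; congr (cochain_fun u _).
  apply/funext => i; rewrite /onat /backshift /=.
  have := ltn_ord i; rewrite ltnS leq_eqVlt => /orP[/eqP ->|i_n].
    by rewrite modnn eqxx.
  by rewrite modn_small.
have f0 : dsum n n.+2 f = 0.
  apply/funext => a; rewrite dsumE /f -hochschildE.
  by have := congr1 (fun v : cyclic_cochain A n.+1 => v (onat a)) u0.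
have := cyclic_acyclic fL fC f0.
case: n => [|n] /= in u u0 uL uC f fL fC f0 *.
  move=> fE; apply/val_inj/funext => a; have [{}a ->] := onatP a.
  exact: (congr1 (fun h : (nat -> A) -> K^o => h a) fE).
move=> [g [gL gC fE]].
(* Beyond [n], [inord] repeats an arbitrary entry, which [g] does not see. *)
pose v : ('I_n.+1 -> A) -> K := fun w => g (fun i => w (inord i)).
have vE a : v (onat a) = g a.
  by apply: (multilin_local gL) => i i_n; rewrite /onat inordK.
have vP : v \in @cyclic_cochain_pred K A n.
  apply/asboolP; split; first exact: multilinear_inord.
  move=> w; rewrite /v -{1}gC /lam muln1; congr (_ * _).
  apply: (multilin_local gL).
  move=> i i_n; rewrite /= /backshift.
  case: (eqVneq i 0%N) => [->|i0]; congr w; apply: val_inj;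
    rewrite /= !inordK//.
  - by rewrite modnn.
  - by rewrite modn_small; lia.
  - by lia.
exists (CyclicCochain vP); apply/val_inj/funext => w; have [a ->] := onatP w.
rewrite /= hochschildE; have <- : f a = u (onat a) by [].
rewrite fE dsumE; apply: eq_bigr => j _; congr (_ * _).
by rewrite -vE.
Qed.

End InfiniteSum.

(** * Injection matrices and block copies *)

Section InfiniteMatrixSums.
Variable K : fieldType.
Implicit Types (a b : nat -> nat -> K^o) (u v : nat -> nat).

(** For injective [u], the isometry sending the basis vector e_j to e_(u j); [coembed u] is its
    transpose. *)
Definition embed u : nat -> nat -> K^o := fun i j => (i == u j)%:R.
Definition coembed u : nat -> nat -> K^o := fun i j => (u i == j)%:R.

Lemma bool_natr_neq0 (e : bool) : (e%:R : K) != 0 -> e.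
Proof. by case: e; rewrite ?eqxx. Qed.

Lemma embed_mulr a u i j : infmx_mul a (embed u) i j = a i (u j).
Proof.
rewrite (@infmx_mul_col K a (embed u) [:: u j])//;
  last by move=> k /bool_natr_neq0; rewrite inE.
by rewrite big_seq1 /embed eqxx mulr1.
Qed.

(** Row [i] is nonzero only if [i] is in the range of [u]; the test detects this, since [v] is
    arbitrary off the range. *)
Lemma embed_mull a u v i j : cancel u v ->
  infmx_mul (embed u) a i j = if u (v i) == i then a (v i) j else 0.
Proof.
move=> uv.
rewrite (@infmx_mul_row K (embed u) a [:: v i])// => [|k /bool_natr_neq0/eqP ->].
  by rewrite big_seq1 /embed eq_sym; case: eqP; rewrite ?mul1r ?mul0r.
by rewrite uv inE.
Qed.

Lemma coembed_mulr a u v i j : cancel u v ->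
  infmx_mul a (coembed u) i j = if u (v j) == j then a i (v j) else 0.
Proof.
move=> uv.
rewrite (@infmx_mul_col K a (coembed u) [:: v j])// => [|k /bool_natr_neq0/eqP <-].
  by rewrite big_seq1 /coembed; case: eqP; rewrite ?mulr1 ?mulr0.
by rewrite uv inE.
Qed.

Lemma row_column_bounded_embed u v : cancel u v -> row_column_bounded (embed u).
Proof.
move=> uv; apply/rcb_seq; exists 2%N, (fun i => [:: u i; v i]) => i.
split=> // j.
by rewrite !inE => -[] /bool_natr_neq0/eqP ->; rewrite ?uv ?eqxx ?orbT.
Qed.

Lemma row_column_bounded_coembed u v :
  cancel u v -> row_column_bounded (coembed u).
Proof.
move=> uv; apply/rcb_seq; exists 2%N, (fun i => [:: u i; v i]) => i.
split=> // j.
by rewrite !inE => -[] /bool_natr_neq0/eqP <-; rewrite ?uv ?eqxx ?orbT.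
Qed.

Lemma finitely_many_entries_bool (e : nat -> nat -> bool) :
  finitely_many_entries (fun i j => (e i j)%:R : K^o).
Proof.
by apply/fmeP; exists [:: 0; 1] => i j; case: (e i j); rewrite !inE eqxx ?orbT.
Qed.

Notation code := Cantor.to_nat.
Notation decode := Cantor.of_nat.

(* The block diagonal matrix with infinitely many blocks [a], the [q]-th row of
   the [p]-th block being the row [code (p, q)]. *)
Definition copies a : nat -> nat -> K^o := fun i j =>
  if (decode i).1 == (decode j).1 then a (decode i).2 (decode j).2 else 0.

Lemma copies_supp (s : nat -> seq nat) a :
  (forall i j, a i j != 0 \/ a j i != 0 -> j \in s i) ->
  forall i j, copies a i j != 0 \/ copies a j i != 0 ->
  j \in [seq code ((decode i).1, q) | q <- s (decode i).2].
Proof.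
move=> sa i j; rewrite /copies [(decode j).1 == _]eq_sym.
case: (eqVneq (decode i).1 (decode j).1) => [E|_]; last by rewrite eqxx; case.
move=> /sa js; apply/mapP; exists (decode j).2 => //.
by rewrite E -surjective_pairing Cantor.cancel_to_of.
Qed.

Lemma row_column_finite_copies a :
  row_column_finite a -> row_column_finite (copies a).
Proof.
by move=> /rcf_seq[s sa]; apply/rcf_seq; eexists; apply: copies_supp; exact: sa.
Qed.

Lemma row_column_bounded_copies a :
  row_column_bounded a -> row_column_bounded (copies a).
Proof.
move=> /rcb_seq[N [s sa]]; apply/rcb_seq; exists N.
exists (fun i => [seq code ((decode i).1, q) | q <- s (decode i).2]) => i.
split; first by rewrite size_map (sa _).1.
by apply: copies_supp => i' j'; exact: (sa _).2.
Qed.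

Lemma finitely_many_entries_copies a :
  finitely_many_entries a -> finitely_many_entries (copies a).
Proof.
move=> /fmeP[s sa]; apply/fmeP; exists (0 :: s) => i j.
by rewrite /copies; case: ifP; rewrite inE ?eqxx// sa orbT.
Qed.

(** A row of [copies a] is supported in its own block, so the product sums over that block only. *)
Lemma copiesM a b : row_column_finite a ->
  copies (infmx_mul a b) = infmx_mul (copies a) (copies b).
Proof.
move=> ha; apply/funext => i; apply/funext => j.
have [s us sa] := row_support ha (decode i).2.
pose r := [seq code ((decode i).1, q) | q <- s].
have codeI p : injective (fun q => code (p, q)).
  by move=> q q' /Cantor.to_nat_inj[].
rewrite (@infmx_mul_row K (copies a) (copies b) r); first last.
- move=> k; rewrite /copies; case: (eqVneq (decode i).1 (decode k).1) =>
    [E /sa ks|_].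
  2: by rewrite eqxx.
  apply/mapP; exists (decode k).2 => //.
  by rewrite E -surjective_pairing Cantor.cancel_to_of.
- by rewrite map_inj_uniq.
rewrite big_map /copies; case: (eqVneq (decode i).1 (decode j).1) => [E|nE].
  rewrite (infmx_mul_row _ _ us sa); apply: eq_bigr => q _.
  by rewrite !Cantor.cancel_of_to/= -E eqxx.
by rewrite big1// => q _; rewrite !Cantor.cancel_of_to/= eqxx (negPf nE) mulr0.
Qed.

(** Hilbert's hotel: [first_block] has block 0 as its range, [next_block] all the others. They give
    [s0] and [s1], and their transposes [t0] and [t1]. *)
Definition first_block q := code (0%N, q).
Definition next_block i := code ((decode i).1.+1, (decode i).2).
Definition block_index i := (decode i).2.
Definition prev_block i := code ((decode i).1.-1, (decode i).2).

Lemma first_blockK : cancel first_block block_index.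
Proof. by move=> q; rewrite /block_index Cantor.cancel_of_to. Qed.

Lemma next_blockK : cancel next_block prev_block.
Proof.
move=> i; have := Cantor.cancel_to_of i.
by rewrite /prev_block Cantor.cancel_of_to/=; case: (decode i).
Qed.

Lemma codeP i : exists p q, i = code (p, q).
Proof.
case E : (decode i) => [p q]; exists p, q.
by rewrite -E Cantor.cancel_to_of.
Qed.

Lemma codeE p q p' q' : (code (p, q) == code (p', q')) = (p == p') && (q == q').
Proof.
apply/eqP/andP => [/Cantor.to_nat_inj[-> ->]//|[/eqP -> /eqP ->]//].
Qed.

Lemma first_neq_next i j : (first_block i == next_block j) = false.
Proof. by rewrite codeE. Qed.

(** Block 0 is [a], and the blocks from 1 on form [copies a] shifted by one block. *)
Lemma copies_split a :
  copies a = infmx_mul (infmx_mul (embed first_block) a) (coembed first_block)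
           + infmx_mul (infmx_mul (embed next_block) (copies a)) (coembed next_block).
Proof.
apply/funext => i; apply/funext => j.
have E x y : (x + y : nat -> nat -> K^o) i j = x i j + y i j by [].
rewrite {}E !(coembed_mulr _ _ _ first_blockK, coembed_mulr _ _ _ next_blockK).
rewrite !(embed_mull _ _ _ first_blockK, embed_mull _ _ _ next_blockK).
have [p [q ->]] := codeP i; have [p' [q' ->]] := codeP j.
rewrite /copies /prev_block /block_index /first_block /next_block.
rewrite !Cantor.cancel_of_to /=.
rewrite !codeE !eqxx !andbT.
by case: p p' => [|p] [|p'] /=; rewrite ?eqxx ?addr0 ?add0r// ?if_same//.
Qed.

(** * Row- and column-finite matrices *)

Definition rcf_embed u v (uv : cancel u v) : rcf_matrix K :=
  RCFMatrix (asboolT (row_column_boundedW (row_column_bounded_embed uv))).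
Definition rcf_coembed u v (uv : cancel u v) : rcf_matrix K :=
  RCFMatrix (asboolT (row_column_boundedW (row_column_bounded_coembed uv))).
Definition rcf_copies (a : rcf_matrix K) : rcf_matrix K :=
  RCFMatrix (asboolT (row_column_finite_copies (rcfP a))).

Lemma rcf_coembed_embed u v u' v' (uv : cancel u v) (uv' : cancel u' v') i j :
  (rcf_coembed uv * rcf_embed uv') i j = (u i == u' j)%:R.
Proof. exact: embed_mulr. Qed.

Lemma rcf_coembedK u v (uv : cancel u v) : rcf_coembed uv * rcf_embed uv = 1.
Proof.
apply/val_inj/funext => i; apply/funext => j.
by rewrite [LHS]rcf_coembed_embed (can_eq uv).
Qed.

Lemma rcf_coembed0 u v u' v' (uv : cancel u v) (uv' : cancel u' v') :
  (forall i j, (u i == u' j) = false) -> rcf_coembed uv * rcf_embed uv' = 0.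
Proof.
move=> uu'; apply/val_inj/funext => i; apply/funext => j.
by rewrite [LHS]rcf_coembed_embed uu'.
Qed.

Lemma rcf_copies_linear : linear rcf_copies.
Proof.
move=> k a b; apply/val_inj/funext => i; apply/funext => j.
rewrite -[RHS]/(k * copies a i j + copies b i j).
rewrite -[LHS]/(copies (k *: rcf_entries a + rcf_entries b) i j) /copies.
by case: ifP => // _; rewrite mulr0 addr0.
Qed.

Lemma rcf_copiesM : {morph rcf_copies : x y / x * y}.
Proof. by move=> a b; apply/val_inj; exact: copiesM (rcfP a). Qed.

Lemma rcf_copies_split (a : rcf_matrix K) : rcf_copies a =
  rcf_embed first_blockK * a * rcf_coembed first_blockK
  + rcf_embed next_blockK * rcf_copies a * rcf_coembed next_blockK.
Proof. by apply/val_inj; exact: copies_split. Qed.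

Lemma next_neq_first i j : (next_block i == first_block j) = false.
Proof. by rewrite eq_sym first_neq_next. Qed.

Hypothesis natK : forall n, (n.+1%:R : K) != 0.

Theorem cyclic_cohomology_rcf n (x : cyclic_cohomology (rcf_matrix K) n) : x = 0.
Proof.
apply: (cyclic_cohomology_infinite_sum rcf_copies_linear rcf_copiesM
  (rcf_coembedK first_blockK) (rcf_coembed0 first_blockK next_blockK first_neq_next)
  (rcf_coembed0 next_blockK first_blockK next_neq_first) (rcf_coembedK next_blockK)
  rcf_copies_split natK).
Qed.

(** * Bounded matrices with finitely many entry values *)

Lemma fbb_embedP u v (uv : cancel u v) : rcf_embed uv \in @fbb_pred K.
Proof.
apply/asboolP; split; first exact: finitely_many_entries_bool.
exact: row_column_bounded_embed uv.
Qed.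

Lemma fbb_coembedP u v (uv : cancel u v) : rcf_coembed uv \in @fbb_pred K.
Proof.
apply/asboolP; split; first exact: finitely_many_entries_bool.
exact: row_column_bounded_coembed uv.
Qed.

Lemma fbb_copiesP (a : fbb_matrix K) : rcf_copies a \in @fbb_pred K.
Proof.
have /asboolP[fa ba] := valP a; apply/asboolP; split.
  exact: finitely_many_entries_copies.
exact: row_column_bounded_copies.
Qed.

Definition fbb_embed u v (uv : cancel u v) := FBBMatrix (fbb_embedP uv).
Definition fbb_coembed u v (uv : cancel u v) := FBBMatrix (fbb_coembedP uv).
Definition fbb_copies (a : fbb_matrix K) := FBBMatrix (fbb_copiesP a).

(** The subalgebra contains the four injection matrices and is stable under [copies], so it inherits
    every relation. *)
Theorem cyclic_cohomology_fbb n (x : cyclic_cohomology (fbb_matrix K) n) : x = 0.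
Proof.
apply: (@cyclic_cohomology_infinite_sum _ _ fbb_copies (fbb_embed first_blockK)
  (fbb_embed next_blockK) (fbb_coembed first_blockK) (fbb_coembed next_blockK)) => //.
- by move=> k a b; apply/val_inj; exact: rcf_copies_linear.
- by move=> a b; apply/val_inj; exact: rcf_copiesM.
- by apply/val_inj; exact: rcf_coembedK.
- by apply/val_inj; exact: rcf_coembed0 first_neq_next.
- by apply/val_inj; exact: rcf_coembed0 next_neq_first.
- by apply/val_inj; exact: rcf_coembedK.
- by move=> a; apply/val_inj; exact: rcf_copies_split.
Qed.

End InfiniteMatrixSums.

Theorem corollary2 (R : realType) (n : nat) :
  (forall x : cyclic_cohomology (fbb_matrix R[i]) n, x = 0) /\
  (forall x : cyclic_cohomology (rcf_matrix R[i]) n, x = 0).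
Proof.
(* Characteristic zero allows the division by n+1 in averaging over rotations. *)
have natC m : (m.+1%:R : R[i]) != 0 by rewrite Num.Theory.pnatr_eq0.
by split=> x; [exact: cyclic_cohomology_fbb|exact: cyclic_cohomology_rcf].
Qed.
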